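(* Let $Q_\emptyset$ be a quasistationary quasifactorizing probability measure on $\mathfrak F_{\mathbb T}$ and let $(Q_{s,t})_{s,t\in\mathbb T}$ be a (measurable) family where $Q_{s,t}$ is a probability measure on $\mathfrak F_{[s,t]}$, such that (Q1) $Q_{s+r,t+r}=Q_{s,t}+r$ for all $r,s,t\in\mathbb T$; (Q2) $(Q_{r,t})_{r,s}\sim(Q_{r,t'})_{r,s}$ and $(Q_{r,t})_{s,t}\sim(Q_{r',t})_{s,t}$ for all $r,r',s,t,t'\in\mathbb T$ with $s\in(r,t)\cap(r,t')\cap(r',t)\cap(r',t')$; (Q3) $Q_{r,t}\sim(Q_{r,t})_{r,s}\ast(Q_{r,t})_{s,t}$ for all $r,t\in\mathbb T$, $s\in(r,t)$; (Q4) $(Q_{r,t})_{s,s'}\sim(Q_\emptyset)_{s,s'}$ for all $r,s,s',t\in\mathbb T$ with $[s,s']\subset(r,t)$. Define the stochastic kernel $q$ on $\mathfrak F_{\mathbb T}$ by $$q(Z)=\delta_Z\ast\mathop{\ast}_{(\alpha,\beta)\subseteq\mathbb T\setminus Z\text{ maximal}}Q_{\alpha,\beta}\quad\text{if }Z\ne\emptyset,\qquad q(\emptyset)=Q_\emptyset,$$ where the convolution is taken over the family of all maximal open subintervals (arcs) of $\mathbb T\setminus Z$. Then for all stationary factorizing measure types $\mathcal M$ on $\mathfrak F_{\mathbb T}$ the measure type $\mathcal M\circ q$ is again stationary and factorizing.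
   Context: $\mathbb T$ is the circle, viewed as $[0,1)$ with addition modulo 1. Intervals are arcs: for $s<t$, $(s,t)$ and $[s,t]$ are the usual ones; for $s\ge t$, $(s,t)=(s,1)\cup[0,t)$ and $[s,t]=[s,1)\cup[0,t]$. $\mathfrak F_K$ is the space of closed subsets of $K$ with the Fell topology and Borel $\sigma$-field. For a measure $\mu$ on $\mathfrak F_{\mathbb T}$ (or on $\mathfrak F_K$ with $K\subseteq\mathbb T$ closed): $\mu_{s,t}$ is the image under $Z\mapsto Z\cap[s,t]$, $\mu+r$ the image under $Z\mapsto Z+r$, and $\mu_1\ast\mu_2$ the image of $\mu_1\otimes\mu_2$ under $(Z_1,Z_2)\mapsto Z_1\cup Z_2$; the infinite convolution in $q(Z)$ is the law of the union of $Z$ with independent random sets distributed according to the $Q_{\alpha,\beta}$ (this union is closed). $\sim$ is mutual absolute continuity; a measure type is an equivalence class of probability measures under $\sim$. A probability measure $\mu$ on $\mathfrak F_{\mathbb T}$ is quasistationary if $\mu+t\sim\mu$ for all $t\in\mathbb T$ and quasifactorizing if $\mu\sim\mu_{s,t}\ast\mu_{t,s}$ for all $s\ne t\in\mathbb T$. A measure type $\mathcal M$ on $\mathfrak F_{\mathbb T}$ is stationary (factorizing) if one, equivalently every, $\mu\in\mathcal M$ is quasistationary (quasifactorizing). $\mathcal M\circ q$ is the measure type of $\mu\circ q=\int\mu(dZ)\,q(Z)(\cdot)$, $\mu\in\mathcal M$. *)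

(* Defs.v *)
From HB Require Import structures.
From mathcomp Require Import all_boot all_order all_algebra finmap.
From mathcomp Require Import all_classical all_reals all_analysis.
From mathcomp Require Import measurable_realfun.
From mathcomp Require Import ring lra.

Set Implicit Arguments.
Unset Strict Implicit.
Unset Printing Implicit Defensive.

Import Order.TTheory GRing.Theory Num.Theory.
Import numFieldNormedType.Exports.

Local Open Scope classical_set_scope.
Local Open Scope ring_scope.

Section circle.
Variable R : realType.

Record circle := Circle { cval : R; cvalP : (0 <= cval) && (cval < 1) }.
HB.instance Definition _ := [isSub for cval].
HB.instance Definition _ := [Choice of circle by <:].

Implicit Types (x y z s t : circle) (a b : R).

Definition fracpart a : R := a - (Num.floor a)%:~R.

Lemma fracpart_itv a : (0 <= fracpart a) && (fracpart a < 1).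
Proof.
have /andP[h1 h2] := floor_itv a.
by rewrite /fracpart subr_ge0 h1 /= ltrBlDl -[X in _ + X]/(1%:~R) -intrD.
Qed.

Definition to_circle a : circle := Circle (fracpart_itv a).

Lemma fracpartDz a (m : int) : fracpart (a + m%:~R) = fracpart a.
Proof.
by rewrite /fracpart floorDrz ?intr_int// intrKfloor intrD opprD addrACA subrr
  addr0.
Qed.

Lemma to_circleDz a (m : int) : to_circle (a + m%:~R) = to_circle a.
Proof. by apply: val_inj; exact: fracpartDz. Qed.

Lemma to_circleE a : exists m : int, a = cval (to_circle a) + m%:~R.
Proof. by exists (Num.floor a); rewrite /= /fracpart subrK. Qed.

Lemma to_circleK x : to_circle (cval x) = x.
Proof.
apply: val_inj; rewrite /= /fracpart (_ : Num.floor (cval x) = 0) ?subr0//.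
by apply: floor_def; rewrite add0r; exact: cvalP.
Qed.

Definition cadd x y := to_circle (cval x + cval y).
Definition copp x := to_circle (- cval x).
Definition czero := to_circle 0.

Lemma to_circleDl a b : to_circle (cval (to_circle a) + b) = to_circle (a + b).
Proof.
have [m am] := to_circleE a.
rewrite -(to_circleDz (cval (to_circle a) + b) m).
by congr to_circle; rewrite addrAC -am.
Qed.

Lemma to_circleDr a b : to_circle (a + cval (to_circle b)) = to_circle (a + b).
Proof. by rewrite addrC to_circleDl addrC. Qed.

Let caddA : associative cadd.
Proof. by move=> x y z; rewrite /cadd to_circleDl to_circleDr addrA. Qed.

Let caddC : commutative cadd.
Proof. by move=> x y; rewrite /cadd addrC. Qed.

Let cadd0 : left_id czero cadd.
Proof. by move=> x; rewrite /cadd to_circleDl add0r to_circleK. Qed.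

Let caddN : left_inverse czero copp cadd.
Proof. by move=> x; rewrite /cadd to_circleDl addNr. Qed.

HB.instance Definition _ :=
  GRing.isZmodule.Build circle caddA caddC cadd0 caddN.
HB.instance Definition _ := isPointed.Build circle (0 : circle).

(* The quotient topology of R / Z, not the subspace topology of [0, 1[:
   the arcs [0, t) are not open. *)
Definition circle_open : set_system circle :=
  [set U | open (to_circle @^-1` U)].

Let circle_openT : circle_open setT.
Proof. exact: openT. Qed.

Let circle_openI : setI_closed circle_open.
Proof. by move=> U V oU oV; exact: openI. Qed.

Let circle_open_bigU (I : Type) (f : I -> set circle) :
  (forall i, circle_open (f i)) -> circle_open (\bigcup_i f i).
Proof.
move=> opf; rewrite /circle_open /= preimage_bigcup.
by apply: bigcup_open => i _; exact: opf.
Qed.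

HB.instance Definition _ :=
  isOpenTopological.Build circle circle_openT circle_openI circle_open_bigU.

HB.instance Definition _ := @isMeasurable.Build (sigma_display (@open circle))
  circle <<s @open circle >> (@sigma_algebra0 _ setT (@open circle))
  (@sigma_algebraC circle (@open circle))
  (@sigma_algebra_bigcup _ setT (@open circle)).

(* (s, t) and [s, t], both running in the positive direction from s to t;
   in particular (s, s) is the circle minus s and [s, s] is the whole circle. *)
Definition oarc s t : set circle :=
  if cval s < cval t then [set x | cval s < cval x < cval t]
  else [set x | (cval s < cval x) || (cval x < cval t)].

Definition carc s t : set circle :=
  if cval s < cval t then [set x | cval s <= cval x <= cval t]
  else [set x | (cval s <= cval x) || (cval x <= cval t)].

Lemma fracpartE a (m : int) :
  m%:~R <= a -> a < (m + 1)%:~R -> fracpart a = a - m%:~R.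
Proof. by move=> h1 h2; rewrite /fracpart (floor_def (m := m)) ?h1. Qed.

Lemma preimage_oarc s t : to_circle @^-1` (oarc s t) =
  \bigcup_(m : int) [set a | cval s + m%:~R < a <
     cval t + (if cval s < cval t then m else m + 1)%:~R].
Proof.
have /andP[s0 s1] := cvalP s; have /andP[t0 t1] := cvalP t.
rewrite /oarc; case: ltP => st; apply/seteqP; split => a /=.
- have [m /= am] := to_circleE a; have /andP[/= a0 a1] := cvalP (to_circle a).
  by move=> /andP[h1 h2]; exists m => //=; apply/andP; split; lra.
- move=> [m _] /= /andP[h1 h2].
  rewrite (@fracpartE a m) ?intrD; last 2 first.
  + lra.
  + lra.
  by apply/andP; split; lra.
- have [m /= am] := to_circleE a; have /andP[/= a0 a1] := cvalP (to_circle a).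
  move=> /orP[h|h].
    by exists m => //=; rewrite intrD; apply/andP; split; lra.
  by exists (m - 1) => //=; rewrite !intrD; apply/andP; split; lra.
move=> [m _] /= /andP[h1]; rewrite intrD => h2.
have [am|am] := ltP a (m + 1)%:~R.
  rewrite (@fracpartE a m) //; last lra.
  by apply/orP; left; lra.
rewrite (@fracpartE a (m + 1)) //; last first.
  by rewrite !intrD; lra.
by apply/orP; right; rewrite intrD; lra.
Qed.

Lemma open_oarc s t : open (oarc s t).
Proof.
suff : circle_open (oarc s t) by [].
rewrite /circle_open /= preimage_oarc; apply: bigcup_open => m _.
rewrite (_ : [set a | _] = `]cval s + m%:~R,
  cval t + (if cval s < cval t then m else m + 1)%:~R[%classic).
  exact: interval_open.
by apply/seteqP; split => a /=; rewrite in_itv.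
Qed.

Lemma closed_carc s t : closed (carc s t).
Proof.
have [/eqP st|st] := boolP (cval s == cval t).
  rewrite (_ : carc s t = setT); first exact: closedT.
  by apply/seteqP; split => // x _; rewrite /carc st ltxx /=; exact: le_total.
rewrite -openC (_ : ~` _ = oarc t s); first exact: open_oarc.
apply/seteqP; split => x; rewrite /carc /oarc /=;
  have [h|h|/eqP] := ltgtP (cval s) (cval t); rewrite ?(negbTE st)//=.
- by move/negP; rewrite negb_and -!ltNge orbC.
- by move/negP; rewrite negb_or -!ltNge andbC.
- by move=> ?; apply/negP; rewrite negb_and -!ltNge orbC.
- by move=> ?; apply/negP; rewrite negb_or -!ltNge andbC.
Qed.

Lemma closed_translate (A : set circle) r :
  closed A -> closed [set x + r | x in A].
Proof.
rewrite -!openC => oA.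
suff : circle_open (~` [set x + r | x in A]) by [].
rewrite /circle_open /= (_ : _ @^-1` _ =
  (fun a => a + cval (- r)) @^-1` (to_circle @^-1` (~` A))).
  apply: open_comp => // a _.
  by apply: cvgD; [exact: cvg_id | exact: cvg_cst].
have E a : to_circle (a + cval (- r)) = to_circle a - r.
  by rewrite -to_circleDl.
apply/seteqP; split => a /=; rewrite E => nA.
  by move=> Aa; apply: nA; exists (to_circle a - r) => //; rewrite subrK.
by move=> [x Ax xa]; apply: nA; rewrite -xa addrK.
Qed.

(* The maximal open arcs contained in the complement of Z, given by their
   end points. *)
Definition gaps (Z : set circle) : set (circle * circle) :=
  [set g | oarc g.1 g.2 `<=` ~` Z /\
     forall h, oarc h.1 h.2 `<=` ~` Z -> oarc g.1 g.2 `<=` oarc h.1 h.2 ->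
       oarc h.1 h.2 = oarc g.1 g.2].

End circle.

Section fell.
Variable X : topologicalType.

Record closedset := ClosedSet { cset :> set X; csetP : closed cset }.
Arguments csetP : clear implicits.

HB.instance Definition _ := gen_eqMixin closedset.
HB.instance Definition _ := gen_choiceMixin closedset.
HB.instance Definition _ := isPointed.Build closedset (ClosedSet (@closed0 X)).

Definition fell_subbase : set (set closedset) :=
  [set U | (exists2 C : set X, compact C &
              U = [set F : closedset | F `&` C = set0]) \/
           (exists2 G : set X, open G &
              U = [set F : closedset | F `&` G !=set0])].

HB.instance Definition _ :=
  @isSubBaseTopological.Build closedset (set closedset) fell_subbase id.

HB.instance Definition _ :=
  @isMeasurable.Build (sigma_display (@open closedset))
  closedset <<s @open closedset >> (@sigma_algebra0 _ setT (@open closedset))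
  (@sigma_algebraC closedset (@open closedset))
  (@sigma_algebra_bigcup _ setT (@open closedset)).

Definition csetU (F G : closedset) : closedset :=
  ClosedSet (closedU (csetP F) (csetP G)).

End fell.
Arguments csetP {X} _.

Definition equivalent d (T : measurableType d) (R : realType)
    (mu nu : set T -> \bar R) : Prop := mu `<< nu /\ nu `<< mu.

Definition same_measure d (T : measurableType d) (R : realType)
    (mu nu : set T -> \bar R) : Prop :=
  forall B, measurable B -> mu B = nu B.

Definition mutually_independent d d' (W : measurableType d)
    (T : measurableType d') (R : realType) (P : probability W R)
    (I : choiceType) (D : set I) (X : I -> {RV P >-> T}) : Prop :=
  forall (J : {fset I}) (B : I -> set T), [set` J] `<=` D ->
    (forall i, measurable (B i)) ->
    P (\bigcap_(i in [set` J]) X i @^-1` B i) =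
    (\prod_(i <- J) P (X i @^-1` B i))%E.

Section random_sets.
Variable R : realType.

Local Notation T := (circle R).
Local Notation FT := (closedset (circle R)).

Implicit Types (s t r : T) (Z : FT) (mu nu : set FT -> \bar R).

Definition trace s t Z : FT :=
  ClosedSet (closedI (csetP Z) (@closed_carc R s t)).

Definition translate r Z : FT := ClosedSet (closed_translate (r := r) (csetP Z)).

Definition restr_law mu s t : set FT -> \bar R := pushforward mu (trace s t).

Definition shift_law mu r : set FT -> \bar R := pushforward mu (translate r).

Definition convolution mu nu : set FT -> \bar R :=
  pushforward (mu \x nu)%E (fun Z : FT * FT => csetU Z.1 Z.2).

(* For a closed set K, the Borel sigma-field of the closed subsets of K is the
   trace of that of FT, so measures on the closed subsets of [s, t] are
   measures on FT carried by the following event. *)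
Definition subsets_of_carc s t : set FT := [set Z : FT | Z `<=` carc s t].

Definition quasistationary mu : Prop := forall t, equivalent (shift_law mu t) mu.

Definition quasifactorizing mu : Prop :=
  forall s t, s != t -> equivalent mu (convolution (restr_law mu s t) (restr_law mu t s)).

Definition measure_type (M : set (probability FT R)) : Prop :=
  exists mu : probability FT R, M = [set nu : probability FT R | equivalent nu mu].

Definition stationary (M : set (probability FT R)) : Prop :=
  forall mu : probability FT R, M mu -> quasistationary mu.

Definition factorizing (M : set (probability FT R)) : Prop :=
  forall mu : probability FT R, M mu -> quasifactorizing mu.

(* nu is the law of the union of Z with independent random closed sets X g of
   law Q g, g running over the gaps of Z, that is, nu is the convolution of
   the Dirac measure at Z and of the measures Q g. *)
Definition gap_convolution (Q : T * T -> {measure set FT -> \bar R}) Z nu : Prop :=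
  exists (d : measure_display) (W : measurableType d) (P : probability W R)
    (X : T * T -> {RV P >-> FT}) (Y : {RV P >-> FT}),
  [/\ mutually_independent (gaps Z) X,
      forall g, gaps Z g -> same_measure (distribution P (X g)) (Q g),
      forall w, Y w = Z `|` \bigcup_(g in gaps Z) X g w :> set T &
      same_measure nu (distribution P Y)].

Definition gap_kernel (Q0 : probability FT R) (Q : T * T -> {measure set FT -> \bar R})
    (q : FT -> probability FT R) : Prop :=
  forall Z, (Z = set0 :> set T -> same_measure (q Z) Q0) /\
            (Z <> set0 :> set T -> gap_convolution Q Z (q Z)).

Definition mixture mu (q : FT -> probability FT R) : set FT -> \bar R :=
  fun B => (\int[mu]_Z q Z B)%E.

Definition type_comp (M : set (probability FT R))
    (q : FT -> probability FT R) : set (probability FT R) :=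
  [set nu : probability FT R |
    exists2 mu : probability FT R, M mu & equivalent nu (mixture mu q)].

End random_sets.

(* Main.v *)
(* Let avoid A be the event that the random set misses A. The events avoid C, C
   closed, form a pi-system generating the Borel sigma-field, so a law is
   determined by its avoidance probabilities, and those of q(Z) are explicit:
   q(Z)(avoid C) is 0 if Z meets C, and otherwise the product of the
   Q_g(avoid C) over the gaps g of Z. Enumerating the gaps along a countable
   dense set gives the measurability of q, and (Q1) gives q(Z + r) ~ q(Z) + r,
   hence stationarity.

   For factorization the infinite product is harmless, because s and t lie in
   at most two gaps of Z. Outside them q(Z) factorizes exactly at s and t, and
   the laws of the two remaining gaps are handled by (Q2)-(Q4). If s, t are not
   in Z, this gives q(Z) ~ q(Z)_{s,t} * q(Z)_{t,s}, and shows that the class of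
   q(Z)_{s,t} depends only on the trace of Z on [s, t]. Hence, for Z and Z'
   avoiding s and t,
     q((Z cap [s,t]) cup (Z' cap [t,s])) ~ q(Z)_{s,t} * q(Z')_{t,s},
   and integrating against mu (x) mu shows that mu o q is quasifactorizing.

   Points s in Z are excluded by a zero-one law: if mu(s in Z) were strictly
   between 0 and 1, then by stationarity this would hold for every s, and by
   factorization every s would with positive probability be a point of Z
   isolated from the left, which is possible for countably many s only. If the
   probability is 1, then Z is the whole circle almost surely. *)

Require Import Defs.
From HB Require Import structures.
From mathcomp Require Import all_boot all_order all_algebra finmap.
From mathcomp Require Import all_classical all_reals all_analysis.
From mathcomp Require Import measurable_realfun.
From mathcomp Require Import lra.

Set Implicit Arguments.
Unset Strict Implicit.
Unset Printing Implicit Defensive.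

Import Order.TTheory GRing.Theory Num.Theory.
Import numFieldNormedType.Exports.

Local Open Scope classical_set_scope.
Local Open Scope ring_scope.

(** * Arcs of the circle *)

Section arcs.
Variable R : realType.
Implicit Types s t x y u a b : circle R.

(** The end points of the gaps are the obstacle in the factorization: nothing says whether a set of
    law Q_{a,b} contains a or b, and two closed windows on a gap often agree on the open gap only.
    But a and b belong to Z, which is part of the union anyway. So laws are compared after a fixed
    closed set E containing these points has been added: Z itself for the splitting, the union of
    the two sets for locality. E is dropped at the end, because the laws that remain contain it
    almost surely. The convolution lives, for each Z, on a probability space of its own, so nothing
    is available jointly in Z except avoidance probabilities. To compare the infinite products of
    two sets with the same trace on [s,t], a gap is numbered by the first point of the dense
    sequence in it. This number depends on the gap alone, so the common gaps have the same number
    for both sets and the products agree factor by factor. Empty sets arise even from nonempty ones: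
    a trace may be empty, and then (Q4) leads to the restriction of Q_∅; a set glued from two traces
    may be empty, and then the quasifactorization of Q_∅ is used. *)

Lemma cvalI x y : cval x = cval y -> x = y.
Proof. exact: val_inj. Qed.

Lemma oarcP s t x : oarc s t x <->
  ((cval s < cval t) && (cval s < cval x < cval t)) ||
  ((cval t <= cval s) && ((cval s < cval x) || (cval x < cval t))).
Proof. by rewrite /oarc; case: ltP => _ /=; rewrite ?orbF. Qed.

Lemma carcP s t x : carc s t x <->
  ((cval s < cval t) && (cval s <= cval x <= cval t)) ||
  ((cval t <= cval s) && ((cval s <= cval x) || (cval x <= cval t))).
Proof. by rewrite /carc; case: ltP => _ /=; rewrite ?orbF. Qed.

Lemma oarcNP s t x : ~ oarc s t x <->
  ((cval s < cval t) && ((cval x <= cval s) || (cval t <= cval x))) ||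
  [&& cval t <= cval s, cval x <= cval s & cval t <= cval x].
Proof.
rewrite /oarc; case: ltP => _ /=; split.
- by move/negP; rewrite negb_and -!leNgt orbF.
- by rewrite orbF => h; apply/negP; rewrite negb_and -!leNgt.
- by move/negP; rewrite negb_or -!leNgt.
- by move=> h; apply/negP; rewrite negb_or -!leNgt.
Qed.

Lemma carcNP s t x : ~ carc s t x <->
  ((cval s < cval t) && ((cval x < cval s) || (cval t < cval x))) ||
  [&& cval t <= cval s, cval x < cval s & cval t < cval x].
Proof.
rewrite /carc; case: ltP => _ /=; split.
- by move/negP; rewrite negb_and -!ltNge orbF.
- by rewrite orbF => h; apply/negP; rewrite negb_and -!ltNge.
- by move/negP; rewrite negb_or -!ltNge.
- by move=> h; apply/negP; rewrite negb_or -!ltNge.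
Qed.

Lemma cneqP x y : x <> y <-> (cval x < cval y) || (cval y < cval x).
Proof.
split; first by move=> xy; rewrite -neq_lt; apply/eqP => /cvalI.
by move=> + xy; rewrite xy ltxx.
Qed.

Lemma ceqP x y : x = y <-> (cval x <= cval y) && (cval y <= cval x).
Proof.
split; first by move->; rewrite lexx.
by rewrite -eq_le => /eqP /cvalI.
Qed.
End arcs.

(* Turns a statement about finitely many points of the circle into linear
   inequalities between their coordinates, splitting the disjunctions one at a
   time so that lra can prune the impossible cases early. *)
Ltac arc_split :=
  repeat match goal with
  | H : is_true (_ || _) |- _ => case/orP: H => H; try (exfalso; lra)
  | H : is_true (_ && _) |- _ =>
      let H' := fresh H in case/andP: H => H H'; try (exfalso; lra)
  end.
Ltac arc_neg :=
  repeat match goal with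
  | H : ~ (oarc _ _ _) |- _ => move/oarcNP: H => H
  | H : ~ (carc _ _ _) |- _ => move/carcNP: H => H
  | H : oarc _ _ _ |- _ => move/oarcP: H => H
  | H : carc _ _ _ |- _ => move/carcP: H => H
  | H : ~ (@eq (circle _) _ _) |- _ => move/cneqP: H => H
  | H : @eq (circle _) _ _ |- _ => move/ceqP: H => H
  end.
Ltac arc :=
  intros; try (match goal with |- ~ _ => move=> ? end);
  apply: contrapT => ?; arc_neg; arc_split; lra.

Section arc_facts.
Variable R : realType.
Implicit Types s t x y u v a b : circle R.

Lemma oarc_carc s t x : oarc s t x -> carc s t x.
Proof. arc. Qed.

Lemma oarc_endl s t : ~ oarc s t s.
Proof. arc. Qed.

Lemma oarc_endr s t : ~ oarc s t t.
Proof. arc. Qed.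

Lemma gap_sub a b a' b' x y : oarc a b x -> oarc a' b' x ->
  ~ oarc a b a' -> ~ oarc a b b' -> oarc a b y -> oarc a' b' y.
Proof. arc. Qed.
End arc_facts.

(** * Topology of the circle: rotations, compactness, rational arcs as a base *)

Section circle_topology.
Variable R : realType.
Implicit Types s t x y u v a b : circle R.

Lemma to_circleD (c d : R) : to_circle (c + d) = to_circle c + to_circle d.
Proof. by rewrite -to_circleDl -to_circleDr. Qed.

Lemma to_circleN (c : R) : to_circle (- c) = - to_circle c :> circle R.
Proof.
by apply/eqP; rewrite -addr_eq0 -to_circleD addNr; apply/eqP.
Qed.

Lemma cval_to_circle (c : R) : 0 <= c -> c < 1 -> cval (to_circle c) = c.
Proof. by move=> c0 c1; rewrite /= (@fracpartE _ _ 0) ?subr0. Qed.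

Lemma cval0 : cval (0 : circle R) = 0.
Proof. by rewrite cval_to_circle. Qed.

Lemma cvalB x s : cval x < cval s /\ cval (x - s) = cval x - cval s + 1 \/
                  cval s <= cval x /\ cval (x - s) = cval x - cval s.
Proof.
have /andP[x0 x1] := cvalP x; have /andP[s0 s1] := cvalP s.
have E : cval (x - s) = cval (to_circle (cval x - cval s)).
  by rewrite to_circleD to_circleN !to_circleK.
rewrite E; have [h|h] := ltP (cval x) (cval s); [left|right]; split => //.
  by rewrite [LHS](@fracpartE _ _ (-1)) ?intrD; lra.
by rewrite cval_to_circle; lra.
Qed.

(** Positions are measured from [s]. The wrap-around disappears except for [cval (t - s) = 0], the
    circle without [s], and rotation invariance becomes visible because only differences occur. *)
Lemma oarc_sub s t x : oarc s t x <-> (0 < cval (x - s)) &&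
  ((cval (x - s) < cval (t - s)) || (cval (t - s) <= 0)).
Proof.
have /andP[? ?] := cvalP x; have /andP[? ?] := cvalP s.
have /andP[? ?] := cvalP t.
have [[? ->]|[? ->]] := cvalB x s; have [[? ->]|[? ->]] := cvalB t s;
  (split; [move=> H; apply: contrapT => /negP|move=> H; apply: contrapT => K]);
  rewrite ?negb_and ?negb_or -?leNgt -?ltNge => *; arc_neg; arc_split; lra.
Qed.

Lemma carc_sub s t x : carc s t x <->
  (cval (x - s) <= cval (t - s)) || (cval (t - s) <= 0).
Proof.
have /andP[? ?] := cvalP x; have /andP[? ?] := cvalP s.
have /andP[? ?] := cvalP t.
have [[? ->]|[? ->]] := cvalB x s; have [[? ->]|[? ->]] := cvalB t s;
  (split; [move=> H; apply: contrapT => /negP|move=> H; apply: contrapT => K]);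
  rewrite ?negb_and ?negb_or -?leNgt -?ltNge => *; arc_neg; arc_split; lra.
Qed.

Lemma subrDD x r s : x + r - (s + r) = x - s.
Proof. by rewrite opprD addrACA subrr addr0. Qed.

Lemma oarcD s t x r : oarc (s + r) (t + r) (x + r) <-> oarc s t x.
Proof. by rewrite !oarc_sub !subrDD. Qed.

Lemma carcD s t x r : carc (s + r) (t + r) (x + r) <-> carc s t x.
Proof. by rewrite !carc_sub !subrDD. Qed.

Lemma to_circle_continuous : continuous (@to_circle R).
Proof. by apply/continuousP => U; exact. Qed.

Lemma to_circle_itv_compact (c d : R) : compact (@to_circle R @` `[c, d]).
Proof.
apply: continuous_compact; last exact: segment_compact.
apply: continuous_subspaceT; exact: to_circle_continuous.
Qed.

Lemma circle_compact : compact [set: circle R].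
Proof.
rewrite (_ : setT = @to_circle R @` `[0, 1]); first exact: to_circle_itv_compact.
apply/seteqP; split => // x _; exists (cval x); last exact: to_circleK.
by have /andP[x0 x1] := cvalP x; rewrite /= in_itv /= x0 ltW.
Qed.

Lemma closed_circle_compact (C : set (circle R)) : closed C -> compact C.
Proof. by move=> cC; apply: (subclosed_compact cC circle_compact). Qed.

(** The dense sequence behind all countability arguments: images of the rationals, in the order of
    their codes. A number that codes no rational gives the point 0. *)
Definition rpt (n : nat) : circle R :=
  to_circle (ratr (odflt 0 (choice.unpickle n : option rat))).

Lemma rpt_dense s t : exists n, oarc s t (rpt n).
Proof.
set e : int := if cval s < cval t then 0 else 1.
have st : cval s < cval t + e%:~R.
  have /andP[s0 s1] := cvalP s; have /andP[t0 t1] := cvalP t.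
  by rewrite /e; case: (ltP (cval s) (cval t)) => h; rewrite ?mulr0z ?mulr1z; lra.
have [p pst] := rat_in_itvoo st.
exists (choice.pickle p).
rewrite /rpt choice.pickleK /= -[oarc _ _ _]/((@to_circle R @^-1` oarc s t) (ratr p)).
rewrite preimage_oarc; exists 0 => //=; move: pst; rewrite in_itv /= addr0.
by rewrite /e; case: ltP.
Qed.

Lemma arc_base (G : set (circle R)) x : open G -> G x -> exists n : nat * nat,
  oarc (rpt n.1) (rpt n.2) x /\ carc (rpt n.1) (rpt n.2) `<=` G.
Proof.
move=> oG Gx.
have oG' : open (@to_circle R @^-1` G) by [].
have : nbhs (cval x) (@to_circle R @^-1` G).
  by apply: open_nbhs_nbhs; split => //=; rewrite to_circleK.
move=> /nbhs_ballP[e0 /= e00 he0].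
(* The bound [4^-1] keeps the lifted interval shorter than 1, so that the arc between the two
   rational points does not wrap around. *)
pose e := Num.min e0 (4^-1).
have e_gt0 : 0 < e by rewrite /e lt_min e00 /=; lra.
have e4 : e <= 4^-1 by rewrite /e ge_min lexx orbT.
have he c : `|cval x - c| < e -> G (to_circle c).
  move=> h; apply: he0; rewrite /ball /=; apply: lt_le_trans h _.
  by rewrite /e ge_min lexx.
have hp : cval x - e < cval x by lra.
have hq : cval x < cval x + e by lra.
have [p] := rat_in_itvoo hp; rewrite in_itv /= => /andP[p1 p2].
have [q] := rat_in_itvoo hq; rewrite in_itv /= => /andP[q1 q2].
exists (choice.pickle p, choice.pickle q); rewrite /rpt !choice.pickleK /=.
set p' := ratr p in p1 p2 *; set q' := ratr q in q1 q2 *.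
have qp : cval (to_circle q' - to_circle p') = q' - p'.
  by rewrite -to_circleN -to_circleD cval_to_circle //; lra.
have pp : to_circle p' - to_circle p' = 0 by rewrite subrr.
split.
  apply/(oarcD _ _ _ (- to_circle p')); rewrite pp; apply/oarcP; rewrite qp cval0.
  have -> : cval (x - to_circle p') = cval x - p'.
    by rewrite -{1}(to_circleK x) -to_circleN -to_circleD cval_to_circle //; lra.
  by apply/orP; left; apply/and3P; split; lra.
move=> y /(carcD _ _ _ (- to_circle p')); rewrite pp => /carcP; rewrite qp cval0.
have /andP[y0 y1] := cvalP (y - to_circle p') => h.
have yq : cval (y - to_circle p') <= q' - p' by arc_split; lra.
rewrite -(subrK (to_circle p') y) -(to_circleK (y - _)) -to_circleD.
by apply: he; rewrite ltr_norml; apply/andP; split; lra.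
Qed.
End circle_topology.

(** * Gaps of a closed set and their end points *)

Section gap_endpoints.
Variable R : realType.
Implicit Types (s t x y u v a b : circle R) (Z : set (circle R)).

Lemma gap_injl a b a' b' x : oarc a b x -> oarc a' b' x ->
  ~ oarc a b a' -> ~ oarc a b b' -> ~ oarc a' b' a -> ~ oarc a' b' b -> a = a'.
Proof. arc. Qed.

Lemma gap_injr a b a' b' x : oarc a b x -> oarc a' b' x ->
  ~ oarc a b a' -> ~ oarc a b b' -> ~ oarc a' b' a -> ~ oarc a' b' b -> b = b'.
Proof. arc. Qed.

(** Distance from [u] to [Z] in the direction [sg], which is 1 or -1. The range [0,1] is a full turn
    and compact, so the infimum is attained if [Z] is closed and nonempty. For empty [Z] the value
    is 0. *)
Definition first_hit (sg : R) u Z : R :=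
  inf [set c | 0 <= c <= 1 /\ Z (to_circle (cval u + sg * c))].

Lemma first_hitP (sg : R) u Z : closed Z -> Z !=set0 -> sg = 1 \/ sg = -1 ->
  [/\ 0 <= first_hit sg u Z <= 1, Z (to_circle (cval u + sg * first_hit sg u Z))
    & forall c, 0 <= c < first_hit sg u Z -> ~ Z (to_circle (cval u + sg * c))].
Proof.
move=> cZ [z Zz] sg1; rewrite /first_hit; set S := [set c | _].
have S0 : S !=set0.
  case: sg1 => sgE.
    exists (cval (z - u)); split.
      by have /andP[-> /ltW ->] := cvalP (z - u).
    by rewrite sgE mul1r to_circleD !to_circleK addrC subrK.
  exists (cval (u - z)); split.
    by have /andP[-> /ltW ->] := cvalP (u - z).
  by rewrite sgE mulN1r to_circleD to_circleN !to_circleK opprB addrC subrK.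
have cS : compact S.
  have -> : S = `[0, 1] `&` (fun c => to_circle (cval u + sg * c)) @^-1` Z.
    by apply/seteqP; split => c; rewrite /S /= in_itv.
  apply: compact_closedI; first exact: segment_compact.
  apply: (closed_comp (f := @to_circle R \o (fun c => cval u + sg * c))) => // c _.
  apply: continuous_comp; last exact: to_circle_continuous.
  by apply: cvgD; [exact: cvg_cst|apply: cvgMr; exact: cvg_id].
have cid : {within S, continuous (id : R -> R)}.
  by apply: continuous_subspaceT => c; exact: cvg_id.
have [c] := compact_EVT_min S0 cS cid.
rewrite inE => Sc cmin.
have lS : lbound S c by move=> d Sd; apply: cmin; rewrite inE.
have -> : inf S = c.
  apply/eqP; rewrite eq_le; apply/andP; split.
    by apply: ge_inf => //; exists c.
  exact: lb_le_inf.
case: (Sc) => c01 Zc; split => // d /andP[d0 dc] Zd.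
have : S d by split => //; rewrite d0 (le_trans (ltW dc))//; case/andP: c01.
by move/lS; rewrite leNgt dc.
Qed.

Definition gap u Z : circle R * circle R :=
  (to_circle (cval u + - 1 * first_hit (- 1) u Z),
   to_circle (cval u + 1 * first_hit 1 u Z)).

Lemma gapP u Z : closed Z -> Z !=set0 -> ~ Z u ->
  [/\ Z (gap u Z).1, Z (gap u Z).2, oarc (gap u Z).1 (gap u Z).2 u &
      oarc (gap u Z).1 (gap u Z).2 `<=` ~` Z].
Proof.
move=> cZ Z0 Zu; rewrite /gap.
have [/andP[h0 h1] Zh hmin] := first_hitP u cZ Z0 (or_introl (erefl 1)).
have [/andP[k0 k1] Zk kmin] := first_hitP u cZ Z0 (or_intror (erefl (-1))).
move: h0 h1 k0 k1 Zh hmin Zk kmin.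
set h := first_hit _ _ _; set k := first_hit _ _ _ => h0 h1 k0 k1.
rewrite mul1r mulN1r => Zh hmin Zk kmin.
have h_gt0 : 0 < h.
  rewrite lt_neqAle h0 andbT; apply/eqP => hE; apply: Zu.
  by rewrite -hE addr0 to_circleK in Zh.
have k_gt0 : 0 < k.
  rewrite lt_neqAle k0 andbT; apply/eqP => kE; apply: Zu.
  by rewrite -kE subr0 to_circleK in Zk.
have hZ c : 0 <= c < h -> ~ Z (to_circle (cval u + c)).
  by move=> /hmin; rewrite mul1r.
have kZ c : 0 <= c < k -> ~ Z (to_circle (cval u - c)).
  by move=> /kmin; rewrite mulN1r.
have h_lt1 : h < 1.
  rewrite lt_neqAle h1 andbT; apply/eqP => hE; apply: Zu.
  by move: Zh; rewrite hE -(to_circleDz _ (-1)) intrN addrK to_circleK.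
(* The point u - k of [Z] is also u + (1 - k), so the forward walk stops there at the latest. *)
have hk : h <= 1 - k.
  rewrite leNgt; apply/negP => kh; apply: (hZ (1 - k)).
    by apply/andP; split; lra.
  by rewrite addrCA addrC (to_circleDz _ 1).
have Eh : cval (to_circle (cval u + h) - u) = h.
  by rewrite to_circleD to_circleK addrC addKr cval_to_circle.
have Ek : cval (to_circle (cval u - k) - u) = 1 - k.
  rewrite to_circleD to_circleK addrC addKr -(to_circleDz _ 1) cval_to_circle mulr1z; lra.
have uE : cval (u - u) = 0 by rewrite subrr cval0.
split => //=.
- apply/(oarcD _ _ _ (- u))/oarcP; rewrite Eh Ek uE; apply/orP; right.
  by rewrite hk h_gt0 orbT.
- move=> x /(oarcD _ _ _ (- u))/oarcP; rewrite Eh Ek.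
  have /andP[c0 c1] := cvalP (x - u).
  rewrite ltNge hk => /orP[//|/orP[kx|xh]].
    rewrite (_ : x = to_circle (cval u - (1 - cval (x - u)))).
      by apply: kZ; apply/andP; split; lra.
    rewrite opprB addrA -[in RHS](to_circleDz _ 1) subrK to_circleD !to_circleK.
    by rewrite addrC subrK.
  rewrite (_ : x = to_circle (cval u + cval (x - u))).
    by apply: hZ; rewrite c0.
  by rewrite to_circleD !to_circleK addrC subrK.
Qed.

Lemma oarc_neq0 s t : exists x, oarc s t x.
Proof. by have [n] := rpt_dense s t; exists (rpt R n). Qed.

(** An arc that misses [Z] cannot pass the ends of the gap around one of its points, since these
    ends lie in [Z]. So a maximal arc equals that gap, and an arc with both ends in [Z] cannot be
    enlarged. *)
Lemma gapsP Z (g : circle R * circle R) : closed Z -> Z !=set0 ->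
  gaps Z g <-> [/\ Z g.1, Z g.2 & oarc g.1 g.2 `<=` ~` Z].
Proof.
case: g => a b /= cZ Z0; split => [[/= gZ gmax]|[Za Zb gZ]].
  have [x gx] := oarc_neq0 a b.
  have [Zk1 Zk2 kx kZ] := gapP cZ Z0 (gZ _ gx).
  move: (gap x Z) Zk1 Zk2 kx kZ => [a' b'] /= Za' Zb' kx kZ.
  have gk : oarc a b `<=` oarc a' b'.
    move=> y gy; apply: (gap_sub gx kx _ _ gy) => [/gZ|/gZ]; exact.
  have kg := gmax (a', b') kZ gk; rewrite /= in kg.
  have na := @oarc_endl R.
  have nb := @oarc_endr R.
  have h1 : ~ oarc a' b' a by rewrite kg; exact: na.
  have h2 : ~ oarc a' b' b by rewrite kg; exact: nb.
  have h3 : ~ oarc a b a' by rewrite -kg; exact: na.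
  have h4 : ~ oarc a b b' by rewrite -kg; exact: nb.
  by rewrite (gap_injl gx kx h3 h4 h1 h2) (gap_injr gx kx h3 h4 h1 h2); split.
split => //= -[a' b'] /= kZ gk.
have [x gx] := oarc_neq0 a b.
have kx := gk _ gx.
have na := @oarc_endl R.
have nb := @oarc_endr R.
have h1 : ~ oarc a' b' a by move/kZ; exact.
have h2 : ~ oarc a' b' b by move/kZ; exact.
have h3 : ~ oarc a b a' by move/gk; exact: na.
have h4 : ~ oarc a b b' by move/gk; exact: nb.
by rewrite (gap_injl gx kx h3 h4 h1 h2) (gap_injr gx kx h3 h4 h1 h2).
Qed.

Lemma gaps_inj Z (g g' : circle R * circle R) x : closed Z -> Z !=set0 ->
  gaps Z g -> gaps Z g' -> oarc g.1 g.2 x -> oarc g'.1 g'.2 x -> g = g'.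
Proof.
move=> cZ Z0 /(gapsP _ cZ Z0) + /(gapsP _ cZ Z0).
case: g g' => a b [a' b'] /= [Za Zb gZ] [Za' Zb' gZ'] gx gx'.
have h1 : ~ oarc a' b' a by move/gZ'; exact.
have h2 : ~ oarc a' b' b by move/gZ'; exact.
have h3 : ~ oarc a b a' by move/gZ; exact.
have h4 : ~ oarc a b b' by move/gZ; exact.
by rewrite (gap_injl gx gx' h3 h4 h1 h2) (gap_injr gx gx' h3 h4 h1 h2).
Qed.

Lemma gaps_gap u Z : closed Z -> Z !=set0 -> ~ Z u -> gaps Z (gap u Z).
Proof. by move=> cZ Z0 Zu; apply/(gapsP _ cZ Z0); have [] := gapP cZ Z0 Zu. Qed.

Lemma gap_eq Z g u : closed Z -> Z !=set0 -> gaps Z g -> oarc g.1 g.2 u ->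
  gap u Z = g.
Proof.
move=> cZ Z0 gg gu.
have Zu : ~ Z u by case/(gapsP _ cZ Z0): (gg) => _ _ /(_ _ gu).
have [_ _ ku _] := gapP cZ Z0 Zu.
exact: (gaps_inj cZ Z0 (gaps_gap cZ Z0 Zu) gg ku gu).
Qed.

End gap_endpoints.

(** * The Borel sigma-field of the Fell topology *)

Section fell_sigma_algebra.
Variable R : realType.
Local Notation T := (circle R).
Local Notation FT := (closedset (circle R)).
Implicit Types (C Z F : FT).

Definition avoid (A : set T) : set FT := [set F : FT | F `&` A = set0].

Lemma avoidU (A B : set T) : avoid (A `|` B) = avoid A `&` avoid B.
Proof.
apply/seteqP; split => F; rewrite /avoid /= setIUr; first by rewrite setU_eq0.
by move=> [-> ->]; rewrite setU0.
Qed.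

Lemma avoid0 : avoid set0 = setT.
Proof. by apply/seteqP; split => // F _; rewrite /avoid /= setI0. Qed.

Lemma avoidP (A : set T) F : avoid A F <-> forall x, cset F x -> ~ A x.
Proof.
split => [h x Fx Ax|h]; first by have : set0 x by rewrite -h.
by apply/seteqP; split => // x [/h].
Qed.

Definition avoid_system : set (set FT) := [set avoid C | C in [set: FT]].

Lemma avoid_systemI : setI_closed avoid_system.
Proof.
move=> _ _ [C _ <-] [C' _ <-]; exists (csetU C C') => //.
by rewrite -avoidU.
Qed.

Lemma avoid_systemT : avoid_system setT.
Proof. by exists (ClosedSet (@closed0 T)) => //; rewrite avoid0. Qed.

Definition carcs (L : seq (nat * nat)) : set T :=
  [set x | exists2 n, n \in L & carc (rpt R n.1) (rpt R n.2) x].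

(** A countable base of the Fell topology: finitely many rational closed arcs to be missed and
    finitely many rational open arcs to be hit. Countability brings all open sets into the
    sigma-field generated by [avoid_system]. *)
Definition fell_base (c : seq (nat * nat) * seq (nat * nat)) : set FT :=
  [set F | avoid (carcs c.1) F /\
    forall n, n \in c.2 -> F `&` oarc (rpt R n.1) (rpt R n.2) !=set0].

Lemma closed_carcs L : closed (carcs L).
Proof.
elim: L => [|n L IH].
  rewrite (_ : carcs _ = set0); first exact: closed0.
  by apply/seteqP; split => // x [].
rewrite (_ : carcs _ = carc (rpt R n.1) (rpt R n.2) `|` carcs L).
  by apply: closedU => //; exact: closed_carc.
apply/seteqP; split => x.
  by move=> [m]; rewrite inE => /orP[/eqP ->|mL] ?; [left|right; exists m].
by move=> [?|[m mL ?]]; [exists n; rewrite ?mem_head|exists m; rewrite // inE mL orbT].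
Qed.

Lemma g_sigma_avoid (A : set T) : closed A -> <<s avoid_system >> (avoid A).
Proof. by move=> cA; apply: sub_sigma_algebra; exists (ClosedSet cA). Qed.

Lemma g_sigma_fell_base c : <<s avoid_system >> (fell_base c).
Proof.
pose TT := g_sigma_algebraType avoid_system.
have mav (A : set T) : closed A -> @measurable _ TT (avoid A) by exact: g_sigma_avoid.
(* Hitting an open arc means hitting one of the countably many rational closed arcs inside it. *)
have mhit s t : @measurable _ TT [set F : FT | F `&` oarc s t !=set0].
  rewrite (_ : [set F | _] = \bigcup_(n in [set n : nat * nat |
      carc (rpt R n.1) (rpt R n.2) `<=` oarc s t])
      ~` avoid (carc (rpt R n.1) (rpt R n.2))).
    rewrite bigcup_mkcond; apply: countable_bigcupT_measurable => [|n]; first exact: countableP.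
    case: ifP => _; last exact: measurable0.
    by apply: measurableC; apply: mav; exact: closed_carc.
  apply/seteqP; split => F /=.
    move=> [x [Fx /(arc_base (@open_oarc _ s t))[n [nx sub]]]].
    by exists n => // /avoidP/(_ _ Fx); apply; exact: oarc_carc.
  move=> [n nst /avoidP /existsNP[x /not_implyP[Fx /contrapT nx]]].
  by exists x; split => //; exact: nst.
suff : @measurable _ TT (fell_base c) by [].
rewrite (_ : fell_base c = avoid (carcs c.1) `&`
  \bigcap_(n in [set` c.2]) [set F : FT | F `&` oarc (rpt R n.1) (rpt R n.2) !=set0]).
  apply: measurableI; first by apply: mav; exact: closed_carcs.
  by apply: fin_bigcap_measurable => // n _; exact: mhit.
by [].
Qed.

Lemma fell_openP (U : set FT) F : open U -> U F ->
  exists2 s : seq (set FT), forall A, A \in s -> fell_subbase A /\ A F &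
    forall G, (forall A, A \in s -> A G) -> U G.
Proof.
move=> [D' sD' <-] [V D'V VF].
have [J sJ JV] := sD' _ D'V.
exists (enum_fset J).
  move=> A AJ; split; first by have := sJ _ AJ; rewrite inE.
  by move: VF; change (V F -> A F); rewrite -JV => /(_ A AJ).
move=> G GJ; exists V => //; change (V G); rewrite -JV => A; exact: GJ.
Qed.

Lemma fell_base_refine (U : set FT) F : open U -> U F ->
  exists2 c, fell_base c F & fell_base c `<=` U.
Proof.
move=> oU UF; have [s hs sU] := fell_openP oU UF.
suff [c Fc cJ] : exists2 c, fell_base c F &
    forall G A, fell_base c G -> A \in s -> A G.
  by exists c => // G cG; apply: sU => A; exact: cJ.
move: hs; clear sU.
elim: s => [_|A s IH hs].
  exists ([::], [::]) => //; split => //=.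
  by apply/avoidP => x _ [n /=]; rewrite in_nil.
have [|c cF cs] := IH; first by move=> B Bs; apply: hs; rewrite inE Bs orbT.
have [AF FA] := hs A (mem_head _ _).
suff [c' c'F c'A] : exists2 c', fell_base c' F & fell_base c' `<=` A.
  have fbc G : fell_base (c.1 ++ c'.1, c.2 ++ c'.2) G <->
      fell_base c G /\ fell_base c' G.
    split.
      move=> [/avoidP h1 h2]; split; split.
      - by apply/avoidP => x /h1 h [n nc ?]; apply: h; exists n; rewrite //= mem_cat nc.
      - by move=> n nc; apply: h2; rewrite /= mem_cat nc.
      - by apply/avoidP => x /h1 h [n nc ?]; apply: h; exists n; rewrite //= mem_cat nc orbT.
      - by move=> n nc; apply: h2; rewrite /= mem_cat nc orbT.
    move=> [[/avoidP h1 h2] [/avoidP h3 h4]]; split.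
      apply/avoidP => x Gx [n /=]; rewrite mem_cat => /orP[nc|nc] ?.
        by apply: (h1 _ Gx); exists n.
      by apply: (h3 _ Gx); exists n.
    by move=> n /=; rewrite mem_cat => /orP[/h2|/h4].
  exists (c.1 ++ c'.1, c.2 ++ c'.2); first exact/fbc.
  move=> G B /fbc[cG c'G]; rewrite inE => /orP[/eqP ->|]; first exact: c'A.
  exact: cs.
case: AF FA => [[C cC ->] /= FC|[G oG ->] /= [x [Fx Gx]]]; last first.
  have [n [nx nG]] := arc_base oG Gx.
  exists ([::], [:: n]).
    split; first by apply/avoidP => y _ [k /=]; rewrite in_nil.
    by move=> m; rewrite inE => /eqP ->; exists x.
  move=> H [_ /(_ n)]; rewrite inE eqxx => /(_ isT)[y [Hy ny]].
  by exists y; split => //; apply: nG; exact: oarc_carc.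
(* The compact set misses [F], so finitely many rational open arcs cover it whose closed versions
   still miss [F]. *)
have oF : open (~` (F : set T)) by rewrite openC; exact: csetP.
move: cC; rewrite compact_cover => /(_ (nat * nat)%type
  [set n | carc (rpt R n.1) (rpt R n.2) `<=` ~` (F : set T)]
  (fun n => oarc (rpt R n.1) (rpt R n.2))).
case => [n _|x Cx|D sD CD]; first exact: open_oarc.
  have Fx : ~ cset F x by move=> Fx; have : set0 x by rewrite -FC.
  by have [n [nx nF]] := arc_base oF Fx; exists n.
exists (enum_fset D, [::]).
  split => //=; apply/avoidP => x Fx [n nD nx].
  by have /[!inE]/(_ x nx) := sD _ nD.
move=> G [/avoidP GD _]; apply/seteqP; split => // x [Gx /CD[n nD nx]].
by apply: (GD _ Gx); exists n => //; exact: oarc_carc.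
Qed.

Lemma open_avoid (A : set T) : compact A -> open (avoid A).
Proof.
move=> cA; exists [set avoid A].
  move=> _ ->; exists [fset avoid A]%fset; last by rewrite set_fset1 bigcap_set1.
  by move=> B; rewrite in_fset1 => /eqP ->; rewrite inE; left; exists A.
by apply/seteqP; split => [F [_ -> //]|F ?]; exists (avoid A).
Qed.

(** Open sets are countable unions of sets [fell_base c]. Conversely [avoid C] is itself open,
    because closed subsets of the circle are compact. *)
Lemma measurable_avoid_system : @measurable _ FT = <<s avoid_system >>.
Proof.
apply/seteqP; split.
  apply: smallest_sub; first exact: smallest_sigma_algebra.
  move=> U oU.
  rewrite (_ : U = \bigcup_(c in [set c | fell_base c `<=` U]) fell_base c).
    pose TT := g_sigma_algebraType avoid_system.
    suff : @measurable _ TT (\bigcup_(c in [set c | fell_base c `<=` U]) fell_base c) by [].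
    rewrite bigcup_mkcond; apply: countable_bigcupT_measurable => [|c]; first exact: countableP.
    by case: ifP => _; [exact: g_sigma_fell_base|exact: measurable0].
  apply/seteqP; split => [F UF|F [c /= cU /cU //]].
  by have [c cF cU] := fell_base_refine oU UF; exists c.
apply: sub_sigma_algebra2 => _ [C _ <-].
exact/open_avoid/closed_circle_compact/csetP.
Qed.
End fell_sigma_algebra.

(** * Restriction, union and translation as measurable maps on closed sets *)

Section fell_measurability.
Variable R : realType.
Local Notation T := (circle R).
Local Notation FT := (closedset (circle R)).
Implicit Types (C Z F K : FT) (mu nu : probability FT R).

Lemma measurable_avoid C : measurable (avoid C).
Proof. by rewrite measurable_avoid_system; exact: g_sigma_avoid (csetP C). Qed.

Lemma avoid_unique (m1 m2 : {measure set FT -> \bar R}) : (m1 setT < +oo)%E ->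
  (forall C, m1 (avoid C) = m2 (avoid C)) -> same_measure m1 m2.
Proof.
move=> m1oo h B mB.
apply: (measure_unique (@avoid_system R) (fun=> setT)) => //.
- exact: measurable_avoid_system.
- exact: avoid_systemI.
- by move=> _; exact: avoid_systemT.
- by rewrite bigcup_const.
- by move=> _ [C _ <-].
Qed.

Lemma measurable_to_fell d (S : measurableType d) (f : S -> FT) :
  (forall C, measurable (f @^-1` avoid C)) -> measurable_fun setT f.
Proof.
move=> h; apply: (measurability _ (@measurable_avoid_system R)).
by move=> _ [_ [C _ <-] <-]; rewrite setTI.
Qed.

(** The sets [A] for which [k ^~ A] is measurable form a lambda-system, and the avoidance events
    form a pi-system. *)
Lemma measurable_avoid_kernel d (S : measurableType d) (k : S -> probability FT R) :
  (forall C, measurable_fun setT (fun x => k x (avoid C))) ->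
  forall B, measurable B -> measurable_fun setT (k ^~ B).
Proof.
move=> h B; rewrite measurable_avoid_system.
pose H := [set A : set FT | measurable A /\ measurable_fun setT (k ^~ A)].
suff : <<s @avoid_system R >> `<=` H by move=> /[apply] -[].
apply: lambda_system_subset => //.
- exact: avoid_systemI.
- split => //.
  + by split => //; rewrite -avoid0; exact: (h (ClosedSet (@closed0 T))).
  + move=> A A' A'A [mA hA] [mA' hA']; split; first exact: measurableD.
    rewrite (_ : k ^~ _ = fun x => (k x A - k x A')%E); last first.
      apply/funext => x; rewrite measureD// ?ltey_eq ?fin_num_measure//.
      by rewrite (setIidr A'A).
    exact: emeasurable_funB.
  + move=> F ndF HF; split.
      by apply: bigcupT_measurable => n; have [] := HF n.
    apply: (emeasurable_fun_cvg (fun n x => k x (F n))).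
      by move=> n; have [] := HF n.
    move=> x _; apply: nondecreasing_cvg_mu => // [n|]; first by have [] := HF n.
    by apply: bigcupT_measurable => n; have [] := HF n.
- by move=> _ [C _ <-]; split; [exact: measurable_avoid|exact: h].
Qed.

Definition cap K F : FT := ClosedSet (closedI (csetP F) (csetP K)).

Lemma preimage_cap K (A : set T) : cap K @^-1` avoid A = avoid (A `&` K).
Proof.
by apply/seteqP; split => F; rewrite /avoid /= (setIC A) setIA.
Qed.

Lemma measurable_cap K : measurable_fun setT (cap K).
Proof.
apply: measurable_to_fell => C.
by rewrite preimage_cap; exact: (measurable_avoid (cap K C)).
Qed.
HB.instance Definition _ K := isMeasurableFun.Build _ _ _ _ (cap K) (measurable_cap K).

Definition cup (p : FT * FT) : FT := csetU p.1 p.2.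

Lemma preimage_cup (A : set T) : cup @^-1` avoid A = avoid A `*` avoid A.
Proof.
by apply/seteqP; split => [[F G]|[F G]]; rewrite /avoid /= setIUl ?setU_eq0.
Qed.

Lemma measurable_cup : measurable_fun setT cup.
Proof.
apply: measurable_to_fell => C.
by rewrite preimage_cup; apply: measurableX; exact: measurable_avoid.
Qed.
HB.instance Definition _ := isMeasurableFun.Build _ _ _ _ cup measurable_cup.

Lemma preimage_translate r (A : set T) :
  translate r @^-1` avoid A = avoid [set x - r | x in A].
Proof.
apply/seteqP; split => F /avoidP h; apply/avoidP => x.
  by move=> Fx [y Ay yx]; apply: (h y) => //; exists x => //; rewrite -yx subrK.
by move=> [y Fy <-] Ay; apply: (h _ Fy); exists (y + r) => //; rewrite addrK.
Qed.

Lemma measurable_translate r : measurable_fun setT (@translate R r).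
Proof.
apply: measurable_to_fell => C; rewrite preimage_translate.
exact: (measurable_avoid (translate (- r) C)).
Qed.
HB.instance Definition _ r :=
  isMeasurableFun.Build _ _ _ _ (@translate R r) (measurable_translate r).

(** [ptr], [pconv] and [pshift] are [restr_law], [convolution] and [shift_law] bundled as
    probabilities and convertible to them, so that the hypotheses on [Q] apply directly. [ptr]
    accepts any closed window, since gaps will be cut out of arcs. *)
Definition ptr K mu : probability FT R := distribution mu (cap K).
Definition pconv mu nu : probability FT R := distribution (mu \x nu)%E cup.
Definition pshift r mu : probability FT R := distribution mu (@translate R r).

Lemma ptrE K mu (A : set T) : ptr K mu (avoid A) = mu (avoid (A `&` K)).
Proof. by rewrite -preimage_cap. Qed.

Lemma pconvE mu nu C : pconv mu nu (avoid C) = (mu (avoid C) * nu (avoid C))%E.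
Proof.
rewrite -product_measure1E -?preimage_cup //; exact: measurable_avoid.
Qed.

Lemma pshiftE r mu (A : set T) : pshift r mu (avoid A) = mu (avoid [set x - r | x in A]).
Proof. by rewrite -preimage_translate. Qed.

End fell_measurability.

(** * Equivalence of laws and mixtures *)

Section equivalence.
Context d (S : measurableType d) (R : realType).
Implicit Types mu nu : {measure set S -> \bar R}.

Lemma equivalentP mu nu : equivalent mu nu <->
  forall B, measurable B -> mu B = 0%E <-> nu B = 0%E.
Proof.
split=> [[/null_content_dominatesP h1 /null_content_dominatesP h2] B mB|h].
  by split; [exact: h2|exact: h1].
by split; apply/null_content_dominatesP => B mB /(h _ mB).
Qed.

Lemma equivalent_refl mu : equivalent mu mu.
Proof. by split. Qed.

Lemma equivalent_sym (mu nu : set S -> \bar R) : equivalent mu nu -> equivalent nu mu.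
Proof. by move=> []. Qed.

Lemma equivalent_trans (mu nu la : set S -> \bar R) :
  equivalent mu nu -> equivalent nu la -> equivalent mu la.
Proof.
by move=> [h1 h2] [h3 h4]; split; [exact: null_dominates_trans h3|exact: null_dominates_trans h2].
Qed.

Lemma same_equivalent mu nu : same_measure mu nu -> equivalent mu nu.
Proof. by move=> h; apply/equivalentP => B mB; rewrite h. Qed.

Lemma equivalent_ae mu nu (Q : set S) : equivalent mu nu ->
  (\forall x \ae mu, Q x) -> \forall x \ae nu, Q x.
Proof.
move=> /equivalentP h [A [mA A0 QA]]; exists A; split => //.
exact/(h _ mA).
Qed.

Lemma integral_eq0P mu (f : S -> \bar R) : measurable_fun setT f ->
  (forall x, 0 <= f x)%E ->
  (\int[mu]_x f x)%E = 0%E <-> (\forall x \ae mu, f x = 0%E).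
Proof.
move=> mf f0; have := ae_eq_integral_abs mu measurableT mf.
rewrite (eq_integral f); last by move=> x _; rewrite gee0_abs.
move=> ->; split; apply: filterS => x; first exact.
by [].
Qed.

End equivalence.

Section mixture.
Context d (S : measurableType d) (R : realType).
Local Notation FT := (closedset (circle R)).
Variables (P : probability S R) (k : S -> probability FT R).
Hypothesis mk : forall B, measurable B -> measurable_fun setT (k ^~ B).

(** The measurability proof is an argument so that the measure structure, whose sigma-additivity
    rests on it, can be attached to the term [mix_measure mk]. *)
Definition mix_measure (_ : forall B, measurable B -> measurable_fun setT (k ^~ B)) :
  set FT -> \bar R := fun B => (\int[P]_x k x B)%E.

Let mix0 : mix_measure mk set0 = 0%E.
Proof. by rewrite /mix_measure integral0_eq// => x _; rewrite measure0. Qed.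

Let mix_ge0 A : (0 <= mix_measure mk A)%E.
Proof. by apply: integral_ge0. Qed.

Let mix_sigma_additive : semi_sigma_additive (mix_measure mk).
Proof.
move=> F mF tF mUF.
rewrite [X in _ --> X](_ : _ = \sum_(n <oo) mix_measure mk (F n))%E.
  by apply/cvg_closeP; split; [exact: is_cvg_nneseries|rewrite closeE].
rewrite -integral_nneseries//; last by move=> n; exact: mk.
by apply: eq_integral => x _; apply/esym/cvg_lim => //=; exact: measure_sigma_additive.
Qed.

HB.instance Definition _ := isMeasure.Build _ _ _ (mix_measure mk)
  mix0 mix_ge0 mix_sigma_additive.

Let mix_setT : mix_measure mk setT = 1%E.
Proof.
rewrite /mix_measure (eq_integral (cst 1%E)); last first.
  by move=> x _; exact: probability_setT.
by rewrite integral_cst// mul1e; exact: probability_setT.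
Qed.

HB.instance Definition _ := Measure_isProbability.Build _ _ _ (mix_measure mk) mix_setT.

Definition pmix : probability FT R := mix_measure mk.

(** An integral of a nonnegative function vanishes iff the function vanishes almost everywhere.
    Hence the class of a mixture depends only on the class of the mixing law and on almost all
    classes of the kernel. *)
Lemma pmix_eq0 B : measurable B ->
  pmix B = 0%E <-> (\forall x \ae P, k x B = 0%E).
Proof. by move=> mB; apply: integral_eq0P; [exact: mk|]. Qed.

End mixture.

Section mixture_equivalence.
Context d (S : measurableType d) (R : realType).
Local Notation FT := (closedset (circle R)).
Implicit Types (P : probability S R) (k : S -> probability FT R).

Lemma pmix_equivalent_base P P' k
  (mk : forall B, measurable B -> measurable_fun setT (k ^~ B)) :
  equivalent P P' -> equivalent (pmix P mk) (pmix P' mk).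
Proof.
move=> PP'; apply/equivalentP => B mB; rewrite !pmix_eq0//.
by split; apply: equivalent_ae; [|exact: equivalent_sym].
Qed.

Lemma pmix_equivalent_ae P k k'
  (mk : forall B, measurable B -> measurable_fun setT (k ^~ B))
  (mk' : forall B, measurable B -> measurable_fun setT (k' ^~ B)) :
  (\forall x \ae P, equivalent (k x) (k' x)) ->
  equivalent (pmix P mk) (pmix P mk').
Proof.
move=> kk'; apply/equivalentP => B mB; rewrite !pmix_eq0//.
by split; apply: filterS2 kk' => x /equivalentP/(_ _ mB)/=; tauto.
Qed.

End mixture_equivalence.

(** * Restriction and convolution up to equivalence *)

Section law_algebra.
Variable R : realType.
Local Notation T := (circle R).
Local Notation FT := (closedset (circle R)).
Implicit Types (C Z F K L : FT) (mu nu la : probability FT R).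

(** The rules for [pconv] and [ptr] below are equalities of laws, checked on avoidance events, where
    a convolution becomes a product. Only the equivalence is kept, to chain them with the hypotheses
    on [Q]. *)
Lemma avoid_equivalent mu nu : (forall C, mu (avoid C) = nu (avoid C)) -> equivalent mu nu.
Proof.
move=> h; apply: same_equivalent; apply: avoid_unique => //.
by rewrite ltey_eq fin_num_measure.
Qed.

Lemma equivalent_distribution d d' (S : measurableType d) (S' : measurableType d')
  (P P' : probability S R)
  (f : {mfun S >-> S'}) :
  equivalent P P' -> equivalent (distribution P f) (distribution P' f).
Proof.
move=> /equivalentP h; apply/equivalentP => B mB.
by apply: h; rewrite -[_ @^-1` _]setTI; exact: measurable_funPT.
Qed.

Lemma equivalent_product mu mu' nu nu' : equivalent mu mu' -> equivalent nu nu' ->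
  equivalent (mu \x nu)%E (mu' \x nu')%E.
Proof.
move=> mm' nn'; apply/equivalentP => B mB.
have E (m n : probability FT R) : (m \x n)%E B = 0%E <-> \forall x \ae m, n (xsection B x) = 0%E.
  apply: (integral_eq0P m (f := fun x => n (xsection B x))) => //.
  exact: measurable_fun_xsection.
have nnB x : nu (xsection B x) = 0%E <-> nu' (xsection B x) = 0%E.
  by move/equivalentP: nn'; apply; exact: measurable_xsection.
rewrite !E; split => h.
  by apply: filterS (equivalent_ae mm' h) => x /nnB.
by apply: filterS (equivalent_ae (equivalent_sym mm') h) => x /nnB.
Qed.

Lemma ptr_equivalent K mu nu : equivalent mu nu -> equivalent (ptr K mu) (ptr K nu).
Proof. exact: equivalent_distribution. Qed.

Lemma pshift_equivalent r mu nu : equivalent mu nu -> equivalent (pshift r mu) (pshift r nu).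
Proof. exact: equivalent_distribution. Qed.

Lemma pconv_equivalent mu mu' nu nu' : equivalent mu mu' -> equivalent nu nu' ->
  equivalent (pconv mu nu) (pconv mu' nu').
Proof. by move=> h h'; apply: equivalent_distribution; exact: equivalent_product. Qed.

Lemma pconvC mu nu : equivalent (pconv mu nu) (pconv nu mu).
Proof. by apply: avoid_equivalent => C; rewrite !pconvE muleC. Qed.

Lemma pconvA mu nu la : equivalent (pconv mu (pconv nu la)) (pconv (pconv mu nu) la).
Proof. by apply: avoid_equivalent => C; rewrite !pconvE muleA. Qed.

Lemma ptr_pconv K mu nu : equivalent (ptr K (pconv mu nu)) (pconv (ptr K mu) (ptr K nu)).
Proof.
by apply: avoid_equivalent => C; rewrite ptrE -[_ `&` _]/(cset (cap K C)) !pconvE !ptrE.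
Qed.

Lemma ptr_ptr K L mu : equivalent (ptr K (ptr L mu)) (ptr (cap L K) mu).
Proof.
apply: avoid_equivalent => C; rewrite ptrE -[_ `&` _]/(cset (cap K C)) !ptrE/=.
by rewrite -setIA (setIC K).
Qed.

End law_algebra.

(** * Measurability of the gaps *)

Section gap_measurability.
Variable R : realType.
Local Notation T := (circle R).
Local Notation FT := (closedset (circle R)).
Implicit Types (s t x y u v a b : T) (C Z F : FT).

Lemma measurable_avoid_compact (A : set T) : compact A -> measurable (avoid A).
Proof. by move=> cA; apply: sub_sigma_algebra; exact: open_avoid. Qed.

Lemma avoid_setT Z : avoid setT Z <-> Z = set0 :> set T.
Proof. by rewrite /avoid /= setIT. Qed.

Lemma measurable_first_hit (sg : R) u : sg = 1 \/ sg = -1 ->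
  measurable_fun setT (fun Z : FT => first_hit sg u Z).
Proof.
move=> sg1; apply: (measurability _ (@RGenOInfty.measurableE R)).
move=> _ [_ [c ->] <-]; rewrite setTI.
have hit0 Z : Z = set0 :> set T -> first_hit sg u Z = 0.
  move=> Z0; rewrite /first_hit (_ : [set _ | _] = set0) ?inf0 //.
  by apply/seteqP; split => // d [_]; rewrite Z0.
have [c0|c0] := ltP c 0.
  rewrite (_ : _ @^-1` _ = setT) //; apply/seteqP; split => // Z _ /=.
  rewrite in_itv /= andbT; apply: (lt_le_trans c0).
  have [/hit0 -> //|/eqP/set0P Z0] := pselect (Z = set0 :> set T).
  by have [/andP[]] := first_hitP u (csetP Z) Z0 sg1.
(* The walk is longer than [c] iff its compact image up to [c] misses the set. The empty set is
   removed because its [first_hit] is 0. *)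
rewrite (_ : _ @^-1` _ =
    avoid ((fun d => to_circle (cval u + sg * d)) @` `[0, c]) `\` avoid setT).
  apply: measurableD; apply: measurable_avoid_compact; last exact: circle_compact.
  apply: continuous_compact; last exact: segment_compact.
  apply: continuous_subspaceT => d.
  apply: continuous_comp; last exact: to_circle_continuous.
  by apply: cvgD; [exact: cvg_cst|apply: cvgMr; exact: cvg_id].
apply/seteqP; split => Z /=; rewrite in_itv /= andbT.
  move=> ch.
  have /eqP/set0P Z0 : Z <> set0 :> set T.
    by move=> /hit0 h0; move: ch; rewrite h0 ltNge c0.
  split; last by move/avoid_setT => ZE; move: Z0; rewrite ZE => -[].
  apply/avoidP => x Zx [d]; rewrite /= in_itv /= => /andP[d0 dc] xE.
  move: Zx; rewrite -xE.
  have [_ _] := first_hitP u (csetP Z) Z0 sg1; apply.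
  by rewrite d0 (le_lt_trans dc).
move=> [/avoidP h /avoid_setT/eqP/set0P Z0]; rewrite ltNge; apply/negP => hc.
have [/andP[h0 _] Zh _] := first_hitP u (csetP Z) Z0 sg1.
by apply: (h _ Zh); exists (first_hit sg u Z) => //; rewrite /= in_itv /= h0.
Qed.

Lemma measurable_to_circle : measurable_fun setT (@to_circle R).
Proof.
apply: (measurability _ (erefl (@measurable _ (circle R)))).
move=> _ [U oU <-]; rewrite setTI; apply: open_measurable.
by move: oU.
Qed.

Lemma measurable_gap u : measurable_fun setT (fun Z : FT => gap u Z).
Proof.
apply: measurable_fun_pair; apply: (measurableT_comp measurable_to_circle);
  apply: measurable_funD => //; apply: measurable_funM => //;
  apply: measurable_first_hit; by [left|right].
Qed.

(* Reformulates "v lies in the gap of Z around u" through avoidance events, so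
   that it is measurable in Z. *)
Definition same_gap u v : set FT :=
  [set Z : FT | u = v \/ avoid (carc u v) Z \/ avoid (carc v u) Z].

Lemma measurable_same_gap u v : measurable (same_gap u v).
Proof.
have [->|/eqP uv] := pselect (u = v).
  by rewrite (_ : same_gap _ _ = setT) //; apply/seteqP; split => // ? _; left.
rewrite (_ : same_gap _ _ = avoid (carc u v) `|` avoid (carc v u)).
  by apply: measurableU; exact: (measurable_avoid (ClosedSet (@closed_carc _ _ _))).
apply/seteqP; split => Z; last by right.
by case=> // uv'; rewrite uv' eqxx in uv.
Qed.

Lemma oarc_extend_right a b u v : oarc a b u -> ~ carc u v a -> ~ carc u v b ->
  oarc a b v.
Proof. arc. Qed.

Lemma oarc_extend_left a b u v : oarc a b u -> ~ carc v u a -> ~ carc v u b ->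
  oarc a b v.
Proof. arc. Qed.

Lemma oarc_one_side a b u v x y : u <> v -> oarc a b u -> oarc a b v ->
  carc u v x -> carc v u y -> ~ oarc a b x -> oarc a b y.
Proof. arc. Qed.

Lemma same_gapP u v Z : Z <> set0 :> set T -> ~ cset Z u ->
  same_gap u v Z <-> oarc (gap u Z).1 (gap u Z).2 v.
Proof.
move=> /eqP/set0P Z0 Zu; have [Za Zb gu gZ] := gapP (csetP Z) Z0 Zu.
move: (gap u Z) Za Zb gu gZ => [a b] /= Za Zb gu gZ; split.
  move=> [<- //|[|]] /avoidP h; [apply: (oarc_extend_right gu)|apply: (oarc_extend_left gu)];
  exact: h.
move=> gv; have [uv|uv] := pselect (u = v); first by left.
right; apply: contrapT => /not_orP[/avoidP/existsNP[x /not_implyP[Zx /contrapT ux]]].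
move=> /avoidP/existsNP[y /not_implyP[Zy /contrapT uy]].
have nx : ~ oarc a b x by move/gZ; exact.
exact: (gZ _ (oarc_one_side uv gu gv ux uy nx)).
Qed.

Local Notation r := (rpt R).

Definition first_seen k : set FT :=
  [set Z | ~ cset Z (r k) /\ forall m, (m < k)%N -> ~ same_gap (r k) (r m) Z].

(** For nonempty [Z], each gap appears exactly once, at the least index of a dense point in it; all
    other indices carry [None]. *)
Definition gap_enum Z k : option (T * T) :=
  if `[< first_seen k Z >] then Some (gap (r k) Z) else None.

Lemma measurable_first_seen k : measurable (first_seen k).
Proof.
rewrite (_ : first_seen k = avoid [set r k] `&`
    \bigcap_(m in `I_k) ~` same_gap (r k) (r m)).
  apply: measurableI; first by apply: measurable_avoid_compact; exact: compact_set1.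
  apply: fin_bigcap_measurable => [|m _]; first exact: finite_II.
  by apply: measurableC; exact: measurable_same_gap.
apply/seteqP; split => Z.
  by move=> [Zk h]; split => //; apply/avoidP => x + xk; rewrite xk.
by move=> [/avoidP Zk h]; split => // /Zk; exact.
Qed.

Definition enumerates (e : nat -> option (T * T)) (D : set (T * T)) :=
  [/\ forall k g, e k = Some g -> D g, forall g, D g -> exists k, e k = Some g
    & forall k m g, e k = Some g -> e m = Some g -> k = m].

Lemma gap_enumP Z : Z <> set0 :> set T -> enumerates (gap_enum Z) (gaps Z).
Proof.
move=> Z0; have /eqP/set0P Z0' := Z0; split.
- move=> k g; rewrite /gap_enum; case: asboolP => // -[Zk _] [<-].
  exact: (gaps_gap (csetP Z) Z0' Zk).
- move=> g gg.
  have ex : exists k, `[< oarc g.1 g.2 (r k) >].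
    by have [k kg] := rpt_dense g.1 g.2; exists k; apply/asboolP.
  case: (ex_minnP ex) => k /asboolP kg kmin; exists k.
  have gE := gap_eq (csetP Z) Z0' gg kg.
  rewrite /gap_enum; case: asboolP => [_|]; first by rewrite gE.
  have Zk : ~ cset Z (r k) by case/(gapsP _ (csetP Z) Z0'): gg => _ _; exact.
  case; split => // m mk /(same_gapP _ Z0 Zk); rewrite gE => mg.
  by have := kmin m; rewrite leqNgt mk => /(_ _)/negP; apply => //; apply/asboolP.
- move=> k m g; rewrite /gap_enum.
  case: asboolP => // -[Zk hk] [kg]; case: asboolP => // -[Zm hm] [mg].
  have [km|mk|//] := ltngtP k m.
    exfalso; apply: (hm _ km); apply/(same_gapP _ Z0 Zm).
    by rewrite mg -kg; case: (gapP (csetP Z) Z0' Zk).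
  exfalso; apply: (hk _ mk); apply/(same_gapP _ Z0 Zk).
  by rewrite kg -mg; case: (gapP (csetP Z) Z0' Zm).
Qed.

End gap_measurability.

(** * The avoidance functional of the gap kernel *)

Section gap_kernel_formula.
Variable R : realType.
Local Notation T := (circle R).
Local Notation FT := (closedset (circle R)).
Implicit Types (s t x y u v a b : T) (C Z F : FT).

Definition oprob (Q : T * T -> {measure set FT -> \bar R}) (A : set T)
    (o : option (T * T)) : R :=
  if o is Some g then fine (Q g (avoid A)) else 1.

Definition avoid_gaps (e : nat -> option (T * T)) (W : Type) (X : T * T -> W -> FT)
    (A : set T) k : set W :=
  if e k is Some g then X g @^-1` avoid A else setT.

Lemma independent_gaps d (W : measurableType d) (P : probability W R)
    (X : T * T -> {RV P >-> FT}) (D : set (T * T)) (e : nat -> option (T * T))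
    (Q : T * T -> {measure set FT -> \bar R}) C n :
  mutually_independent D X -> enumerates e D ->
  (forall g, D g -> same_measure (distribution P (X g)) (Q g)) ->
  P (\bigcap_(k in `I_n) avoid_gaps e X C k) = (\prod_(k < n) oprob Q C (e k))%:E.
Proof.
move=> indep [eD _ einj] XQ.
(* Independence is formulated for finite sets of gaps, so the gaps among the first [n] indices are
   listed; injectivity of [e] excludes repetitions. *)
pose s := pmap e (iota 0 n).
have sP g : g \in s <-> exists2 k, (k < n)%N & e k = Some g.
  rewrite mem_pmap; split => [/mapP[k kn ekg]|[k kn ekg]].
    by exists k => //; move: kn; rewrite mem_iota.
  by apply/mapP; exists k => //; rewrite mem_iota.
have us : uniq s.
  rewrite /s; elim: (iota 0 n) (iota_uniq 0 n) => //= k l IH /andP[kl /IH ul].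
  case ek: (e k) => [g|] //=; rewrite ul andbT mem_pmap.
  by apply/negP => /mapP[m ml /esym em]; rewrite (einj _ _ _ ek em) ml in kl.
pose J := [fset g in s]%fset.
have -> : \bigcap_(k in `I_n) avoid_gaps e X C k =
    \bigcap_(g in [set` J]) X g @^-1` avoid C.
  apply/seteqP; split => w h.
    move=> g /=; rewrite inE => /sP[k kn ek].
    by have := h k kn; rewrite /avoid_gaps ek.
  move=> k kn; rewrite /avoid_gaps; case ek: (e k) => [g|] //; apply: h.
  by rewrite /= inE; apply/sP; exists k.
rewrite (indep J (fun=> avoid C)); last 2 first.
- by move=> g /=; rewrite inE => /sP[k _ /eD].
- by move=> _; exact: measurable_avoid.
have pJ : perm_eq (enum_fset J) s.
  apply: uniq_perm; [exact: fset_uniq|exact: us|move=> g].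
  by rewrite -[_ \in enum_fset _]/(g \in J) inE.
rewrite (perm_big _ pJ) /= -(big_mkord xpredT (fun k => oprob Q C (e k))) /index_iota subn0.
rewrite /s; elim: (iota 0 n) => [|k l IH]; first by rewrite !big_nil.
rewrite /= big_cons; case ek: (e k) => [g|] /=; last by rewrite mul1r.
rewrite big_cons EFinM IH; congr (_ * _)%E.
have Dg := eD _ _ ek.
have -> : P (X g @^-1` avoid C) = Q g (avoid C).
  by apply: (XQ _ Dg); exact: measurable_avoid.
rewrite fineK // -(XQ _ Dg _ (measurable_avoid C)).
exact: (fin_num_measure (distribution P (X g)) _ (measurable_avoid C)).
Qed.

Variables (Q0 : probability FT R) (Q : R.-pker (T * T)%type ~> FT).
Variable (q : FT -> probability FT R).
Hypothesis q_def : gap_kernel Q0 Q q.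

Lemma gap_kernel_hit Z C : Z <> set0 :> set T -> ~ avoid C Z -> q Z (avoid C) = 0%E.
Proof.
move=> Z0 ZC; have [d [W [P [X [Y [_ _ YE qE]]]]]] := (q_def Z).2 Z0.
rewrite (qE _ (measurable_avoid C)).
change (P (Y @^-1` avoid C) = 0%E).
rewrite (_ : _ @^-1` _ = set0) ?measure0 //.
apply/seteqP; split => // w /= /avoidP YC; apply: ZC; apply/avoidP => x Zx.
by apply: YC; rewrite [cset _]YE; left.
Qed.

(** Continuity from above: as [Z] misses [C], the union misses [C] iff the random sets of all gaps
    do, a decreasing intersection over the first [n] gaps. Any enumeration is allowed, which is used
    for translates. *)
Lemma gap_kernel_cvg Z C e : Z <> set0 :> set T -> enumerates e (gaps Z) ->
  avoid C Z ->
  (fun n => \prod_(k < n) oprob Q C (e k)) @ \oo --> fine (q Z (avoid C)).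
Proof.
move=> Z0 eZ ZC; have [d [W [P [X [Y [indep XQ YE qE]]]]]] := (q_def Z).2 Z0.
have mA k : measurable (avoid_gaps e X C k).
  rewrite /avoid_gaps; case: (e k) => // g.
  by rewrite -[_ @^-1` _]setTI; apply: measurable_funPT => //; exact: measurable_avoid.
have mF n : measurable (\bigcap_(k in `I_n) avoid_gaps e X C k).
  by apply: fin_bigcap_measurable => // k _.
have YF : Y @^-1` avoid C = \bigcap_n \bigcap_(k in `I_n) avoid_gaps e X C k.
  case: eZ => eD De _; apply/seteqP; split => w.
    move=> /avoidP YC n _ k kn; rewrite /avoid_gaps; case ek: (e k) => [g|] //.
    apply/avoidP => x Xx; apply: YC; rewrite [cset _]YE; right.
    by exists g => //; exact: eD ek.
  move=> h; apply/avoidP => x; rewrite [cset _]YE => -[Zx|[g Dg Xx]].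
    by move/avoidP: ZC; exact.
  have [k ek] := De _ Dg.
  by have := h k.+1 I k (ltnSn k); rewrite /avoid_gaps ek => /avoidP; exact.
have : P \o (fun n => \bigcap_(k in `I_n) avoid_gaps e X C k) @ \oo -->
    P (\bigcap_n \bigcap_(k in `I_n) avoid_gaps e X C k).
  apply: nonincreasing_cvg_mu => //.
  - by rewrite ltey_eq fin_num_measure.
  - exact: bigcapT_measurable.
  - move=> m n mn; apply/subsetPset => w h k /= km; apply: h => /=.
    exact: leq_trans km mn.
rewrite -YF (_ : P (Y @^-1` avoid C) = q Z (avoid C)); last first.
  by rewrite (qE _ (measurable_avoid C)).
rewrite (_ : _ \o _ = EFin \o (fun n => \prod_(k < n) oprob Q C (e k))); last first.
  by apply/funext => n /=; exact: (independent_gaps C n indep eZ XQ).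
rewrite -{1}(@fineK _ (q Z (avoid C))) ?fin_num_measure //; last exact: measurable_avoid.
by move/fine_cvgP => [_].
Qed.

Lemma measurable_oprob C k : measurable_fun setT (fun Z => oprob Q C (gap_enum Z k)).
Proof.
rewrite (_ : (fun Z => _) = fun Z => if `[< first_seen k Z >] then
    fine (Q (gap (rpt R k) Z) (avoid C)) else 1); last first.
  by apply/funext => Z; rewrite /gap_enum; case: asboolP.
apply: measurable_fun_ifT => //.
  apply: (@measurable_fun_bool _ _ _ _ true); rewrite setTI.
  rewrite (_ : _ @^-1` _ = first_seen k); first exact: measurable_first_seen.
  by apply/seteqP; split => Z /= /asboolP.
apply: (measurableT_comp (f := fine) (g := fun Z : FT => Q (gap (rpt R k) Z) (avoid C))) => //.
apply: (measurableT_comp (f := fun g => Q g (avoid C))).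
  by apply: measurable_kernel; exact: measurable_avoid.
exact: measurable_gap.
Qed.

Lemma measurable_gap_kernel B : measurable B -> measurable_fun setT (q ^~ B).
Proof.
apply: measurable_avoid_kernel => C.
have mb (A : set FT) : measurable A -> measurable_fun setT (fun Z : FT => `[< A Z >]).
  move=> mA; apply: (@measurable_fun_bool _ _ _ _ true); rewrite setTI.
  rewrite (_ : _ @^-1` _ = A) //.
  by apply/seteqP; split => Z /= /asboolP.
apply: (emeasurable_fun_cvg (fun n Z => if `[< avoid setT Z >] then Q0 (avoid C) else
  if `[< avoid C Z >] then (\prod_(k < n) oprob Q C (gap_enum Z k))%:E else 0%E)).
  move=> n; apply: measurable_fun_ifT => //.
    by apply: mb; apply: measurable_avoid_compact; exact: circle_compact.
  apply: measurable_fun_ifT => //; first by apply: mb; exact: measurable_avoid.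
  apply/measurable_EFinP.
  by apply: measurable_prod => k _; exact: measurable_oprob.
move=> Z _; case: asboolP => [/avoid_setT Z0|/avoid_setT Z0].
  rewrite ((q_def Z).1 Z0 _ (measurable_avoid C)); exact: cvg_cst.
case: asboolP => ZC; last by rewrite gap_kernel_hit //; exact: cvg_cst.
rewrite -(@fineK _ (q Z (avoid C))) ?fin_num_measure //; last exact: measurable_avoid.
apply: cvg_EFin; first by apply: nearW.
exact: gap_kernel_cvg (gap_enumP Z0) ZC.
Qed.

End gap_kernel_formula.

(** * Translating and factoring the product over the gaps *)

Section gap_kernel_product.
Variable R : realType.
Local Notation T := (circle R).
Local Notation FT := (closedset (circle R)).
Implicit Types (s t x y u v a b : T) (C Z F : FT) (g h : T * T).

Lemma measurable_avoid_open (U : set T) : open U -> measurable (avoid U).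
Proof.
move=> oU; rewrite -[avoid U]setCK; apply: measurableC.
apply: sub_sigma_algebra.
rewrite (_ : ~` _ = [set F : FT | F `&` U !=set0]).
  exists [set [set F : FT | F `&` U !=set0]].
    move=> _ ->; exists [fset [set F : FT | F `&` U !=set0]]%fset;
      last by rewrite set_fset1 bigcap_set1.
    by move=> B; rewrite in_fset1 => /eqP ->; rewrite inE; right; exists U.
  by apply/seteqP; split => [F [_ -> //]|F ?]; exists [set F : FT | F `&` U !=set0].
apply/seteqP; split => F; rewrite /setC /avoid /=; first by move/eqP/set0P.
by move=> /set0P/eqP.
Qed.

Lemma subsets_of_carcE s t : subsets_of_carc s t = avoid (~` carc s t).
Proof.
apply/seteqP; split => F; first by move=> h; apply/avoidP => x /h ? ; exact.
by move=> /avoidP h x /h /contrapT.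
Qed.

Lemma measurable_subsets_of_carc s t : measurable (subsets_of_carc s t : set FT).
Proof.
rewrite subsets_of_carcE; apply: measurable_avoid_open.
by rewrite openC; exact: closed_carc.
Qed.

Lemma carried_avoid (mu : probability FT R) s t (A B : FT) :
  mu (subsets_of_carc s t) = 1%E ->
  (forall x, carc s t x -> cset A x <-> cset B x) -> mu (avoid A) = mu (avoid B).
Proof.
move=> mu1 AB; have mS := @measurable_subsets_of_carc s t.
have full C : mu (avoid C) = mu (avoid C `&` subsets_of_carc s t).
  rewrite [LHS](measureDI _ (measurable_avoid C) mS).
  rewrite [X in (X + _)%E](_ : _ = 0%E) ?add0e //; apply/eqP.
  rewrite -measure_le0; apply: (@le_trans _ _ (mu (~` subsets_of_carc s t))).
    by apply: le_measure; rewrite ?inE; [apply: measurableD => //;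
      exact: measurable_avoid|exact: measurableC|move=> F []].
  by rewrite probability_setC // mu1 subee.
rewrite !full; congr (mu _); apply/seteqP.
by split => F [/avoidP FA FS]; split => //; apply/avoidP => x Fx;
  [move/(AB _ (FS _ Fx))|move/(AB _ (FS _ Fx))]; exact: FA.
Qed.

Definition plaw_fun (Q : R.-pker (T * T)%type ~> FT) g : set FT -> \bar R := Q g.
HB.instance Definition _ Q g := Measure.on (@plaw_fun Q g).
HB.instance Definition _ Q g := Measure_isProbability.Build _ _ _ (@plaw_fun Q g)
  (@prob_kernel _ _ _ _ _ Q g).
Definition plaw Q g : probability FT R := @plaw_fun Q g.

Lemma gaps_translate (r : T) Z g : Z <> set0 :> set T ->
  gaps (translate r Z) g <-> gaps Z (g.1 - r, g.2 - r).
Proof.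
move=> /eqP/set0P Z0.
have Zr0 : cset (translate r Z) !=set0 by case: Z0 => z Zz; exists (z + r), z.
have Er x : cset (translate r Z) x = cset Z (x - r).
  apply/propext; split; first by move=> [y Zy <-]; rewrite addrK.
  by move=> Zx; exists (x - r) => //; rewrite subrK.
rewrite (gapsP _ (csetP (translate r Z)) Zr0) (gapsP _ (csetP Z) Z0) !Er.
split => -[h1 h2 h3]; split => // x gx.
  move=> Zx; apply: (h3 (x + r)); last by rewrite Er addrK.
  by rewrite -(subrK r g.1) -(subrK r g.2); apply/oarcD.
rewrite /setC /mkset Er; apply: h3.
by apply/(oarcD _ _ _ r); rewrite !subrK.
Qed.

Lemma enumerates_translate (r : T) Z e : Z <> set0 :> set T ->
  enumerates e (gaps Z) ->
  enumerates (fun k => omap (fun g : T * T => (g.1 + r, g.2 + r)) (e k))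
    (gaps (translate r Z)).
Proof.
move=> Z0 [eD De einj]; split.
- move=> k g; case ek: (e k) => [[a b]|] //= -[<-].
  by apply/gaps_translate => //=; rewrite !addrK; exact: eD ek.
- move=> [a b] /gaps_translate => /(_ Z0)/De/= [k ek]; exists k.
  by rewrite ek /= !subrK.
- have finj : injective (fun g : T * T => (g.1 + r, g.2 + r)).
    move=> [a b] [a' b'] E.
    have E1 : a + r = a' + r := congr1 fst E.
    have E2 : b + r = b' + r := congr1 snd E.
    by rewrite (addIr _ E1) (addIr _ E2).
  move=> k m g; case ek: (e k) => [g1|] // gE.
  case em: (e m) => [g2|] // hE; apply: einj ek _; rewrite em; congr Some.
  by apply: finj; apply: Some_inj; exact: etrans hE (esym gE).
Qed.

Variables (Q0 : probability FT R) (Q : R.-pker (T * T)%type ~> FT).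
Variable (q : FT -> probability FT R).
Hypothesis q_def : gap_kernel Q0 Q q.

Lemma probability_avoid (mu : probability FT R) C :
  mu (avoid C) = (fine (mu (avoid C)))%:E.
Proof. by rewrite fineK// fin_num_measure//; exact: measurable_avoid. Qed.

(** The gaps of the translate are enumerated by translating [gap_enum Z], so that (Q1) matches the
    two products factor by factor. *)
Lemma gap_kernel_translate (r : T) Z :
  (forall r s t, same_measure (Q (s + r, t + r)) (shift_law (Q (s, t)) r)) ->
  Z <> set0 :> set T -> equivalent (q (translate r Z)) (pshift r (q Z)).
Proof.
move=> Q1 Z0; have eZ := gap_enumP Z0.
have eZr := enumerates_translate r Z0 eZ.
have Zr0 : translate r Z <> set0 :> set T.
  have /eqP/set0P[z Zz] := Z0.
  by move=> E; have : set0 (z + r) by rewrite -E; exists z.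
apply: avoid_equivalent => C.
have avE : avoid C (translate r Z) <-> avoid (translate (- r) C) Z.
  by have := preimage_translate r C => /seteqP[h1 h2]; split; [exact: h1|exact: h2].
rewrite pshiftE -[X in _ = q Z (avoid X)]/(cset (translate (- r) C)).
have [h|h] := pselect (avoid C (translate r Z)); last first.
  rewrite (gap_kernel_hit q_def Zr0 h) (gap_kernel_hit q_def Z0) //.
  by move/avE.
rewrite [LHS]probability_avoid [RHS]probability_avoid; congr EFin.
rewrite -(cvg_lim (@Rhausdorff R) (gap_kernel_cvg q_def Zr0 eZr h)).
apply: cvg_lim; first exact: Rhausdorff.
rewrite (_ : (fun n => _) = (fun n => \prod_(k < n) oprob Q (translate (- r) C) (gap_enum Z k))).
  by apply: (gap_kernel_cvg q_def Z0 eZ); apply/avE.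
apply/funext => n; apply: eq_bigr => k _.
case: (gap_enum Z k) => [[a b]|] //=.
by rewrite (Q1 _ _ _ _ (measurable_avoid C)) /shift_law /pushforward preimage_translate.
Qed.

(** A factorization of each factor passes to the limit, and both sides vanish if [Z] meets [A]. It
    is applied with every factor split in two, and with a single [c k] allowed to differ from 1. *)
Lemma gap_kernel_factor Z (A A1 : FT) (c : nat -> R) l : Z <> set0 :> set T ->
  (avoid A Z <-> avoid A1 Z) ->
  (avoid A Z -> forall k, oprob Q A (gap_enum Z k) = oprob Q A1 (gap_enum Z k) * c k) ->
  (fun n => \prod_(k < n) c k) @ \oo --> l ->
  q Z (avoid A) = (q Z (avoid A1) * l%:E)%E.
Proof.
move=> Z0 AA1 h cl; have eZ := gap_enumP Z0.
have [ZA|ZA] := pselect (avoid A Z); last first.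
  by rewrite !(gap_kernel_hit q_def) ?mul0e// => /AA1.
rewrite [LHS]probability_avoid (probability_avoid _ A1) -EFinM; congr EFin.
rewrite -(cvg_lim (@Rhausdorff R) (gap_kernel_cvg q_def Z0 eZ ZA)).
apply: cvg_lim; first exact: Rhausdorff.
rewrite (_ : (fun n => _) = (fun n => \prod_(k < n) oprob Q A1 (gap_enum Z k)) \*
   (fun n => \prod_(k < n) c k)).
  by apply: cvgM cl; exact: (gap_kernel_cvg q_def Z0 eZ (AA1.1 ZA)).
apply/funext => n /=; rewrite -big_split /=; apply: eq_bigr => k _; exact: h.
Qed.

Lemma gap_kernel_mul Z (A A1 A2 : FT) : Z <> set0 :> set T ->
  (avoid A Z <-> avoid A1 Z /\ avoid A2 Z) ->
  (avoid A Z -> forall g, gaps Z g ->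
    Q g (avoid A) = (Q g (avoid A1) * Q g (avoid A2))%E) ->
  q Z (avoid A) = (q Z (avoid A1) * q Z (avoid A2))%E.
Proof.
move=> Z0 AA h; have eZ := gap_enumP Z0.
have [ZA|ZA] := pselect (avoid A Z); last first.
  have [ZA1|ZA1] := pselect (avoid A1 Z); last first.
    by rewrite (gap_kernel_hit q_def Z0 ZA) (gap_kernel_hit q_def Z0 ZA1) mul0e.
  have ZA2 : ~ avoid A2 Z by tauto.
  by rewrite (gap_kernel_hit q_def Z0 ZA) (gap_kernel_hit q_def Z0 ZA2) mule0.
have [ZA1 ZA2] := AA.1 ZA.
rewrite (probability_avoid (q Z) A2).
apply: (gap_kernel_factor (c := fun k => oprob Q A2 (gap_enum Z k))) => //; last first.
  exact: (gap_kernel_cvg q_def Z0 eZ ZA2).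
move=> _ k; case: eZ => eD _ _; case ek: (gap_enum Z k) => [g|] /=; last by rewrite mulr1.
rewrite (h ZA _ (eD _ _ ek)) fineM //;
  exact: (fin_num_measure (plaw Q g) _ (measurable_avoid _)).
Qed.

Lemma gap_kernel_remove Z (A A1 : FT) g : Z <> set0 :> set T -> gaps Z g ->
  (avoid A Z <-> avoid A1 Z) -> (avoid A Z -> Q g (avoid A1) = 1%E) ->
  (avoid A Z -> forall h, gaps Z h -> h <> g -> Q h (avoid A) = Q h (avoid A1)) ->
  q Z (avoid A) = (q Z (avoid A1) * Q g (avoid A))%E.
Proof.
move=> Z0 gg AA1 A1g Ah; have [eD De einj] := gap_enumP Z0.
have [n0 en0] := De _ gg.
rewrite -[Q g _]/(plaw Q g (avoid A)) (probability_avoid (plaw Q g)).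
set l := fine _.
apply: (gap_kernel_factor (c := fun k => if k == n0 then l else 1)) => //.
  move=> ZA k; have [->|kn0] := eqVneq k n0.
    by rewrite en0 /= A1g //= mul1r.
  case ek: (gap_enum Z k) => [h|] /=; rewrite mulr1 //.
  rewrite (Ah ZA _ (eD _ _ ek)) // => hg; move: kn0.
  by rewrite (einj k n0 g) ?eqxx // ek hg.
(* The partial products are constantly [l] once they include the index [n0]. *)
apply/cvg_ballP => e e0; exists n0.+1 => // n /= nn0.
rewrite (_ : \prod_(k < n) _ = l); first exact: ballxx.
rewrite (bigD1 (Ordinal nn0)) //= eqxx big1 ?mulr1 // => i /eqP ni.
by case: eqP => // in0; exfalso; apply: ni; apply: val_inj.
Qed.
End gap_kernel_product.

(** * Equivalence modulo a fixed set *)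

Section equivalence_modulo.
Variable R : realType.
Local Notation T := (circle R).
Local Notation FT := (closedset (circle R)).
Implicit Types (C Z F K L E : FT) (mu nu la : probability FT R).

Definition pdirac E : probability FT R := @dirac _ FT E R.

Lemma pdirac_avoid E C : avoid C E -> pdirac E (avoid C) = 1%E.
Proof. by move=> EC; rewrite /pdirac /= diracE mem_set. Qed.

Lemma pdirac_hit E C : ~ avoid C E -> pdirac E (avoid C) = 0%E.
Proof. by move=> EC; rewrite /pdirac /= diracE memNset. Qed.

(* Equivalence of the two laws once the fixed set E is added to both random
   sets: this makes the behaviour at the end points of the gaps irrelevant. *)
Definition eqm E mu nu := equivalent (pconv (pdirac E) mu) (pconv (pdirac E) nu).

(** Expresses through avoidance events that the random set contains [E] almost surely. Between such
    laws [eqm E] is plain equivalence. *)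
Definition absorbs E mu := forall C, ~ avoid C E -> mu (avoid C) = 0%E.

Lemma eqm_refl E mu : eqm E mu mu.
Proof. exact: equivalent_refl. Qed.

Lemma eqm_sym E mu nu : eqm E mu nu -> eqm E nu mu.
Proof. exact: equivalent_sym. Qed.

Lemma eqm_trans E mu nu la : eqm E mu nu -> eqm E nu la -> eqm E mu la.
Proof. exact: equivalent_trans. Qed.

Lemma equivalent_eqm E mu nu : equivalent mu nu -> eqm E mu nu.
Proof. by move=> h; apply: pconv_equivalent => //; exact: equivalent_refl. Qed.

Lemma eqm_avoid E mu nu :
  (forall C, avoid C E -> mu (avoid C) = nu (avoid C)) -> eqm E mu nu.
Proof.
move=> h; apply: avoid_equivalent => C; rewrite !pconvE.
have [EC|EC] := pselect (avoid C E); first by rewrite h.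
by rewrite pdirac_hit ?mul0e.
Qed.

Lemma pdirac_absorbs E mu : absorbs E mu -> equivalent (pconv (pdirac E) mu) mu.
Proof.
move=> h; apply: avoid_equivalent => C; rewrite pconvE.
have [EC|EC] := pselect (avoid C E); first by rewrite pdirac_avoid ?mul1e.
by rewrite pdirac_hit ?mul0e ?h.
Qed.

Lemma eqm_absorbs E mu nu : absorbs E mu -> absorbs E nu -> eqm E mu nu ->
  equivalent mu nu.
Proof.
move=> /pdirac_absorbs hm /pdirac_absorbs hn h.
apply: equivalent_trans (equivalent_sym hm) _.
exact: equivalent_trans h hn.
Qed.

(** The Dirac law at [E] is idempotent under convolution, so adding [E] to a union amounts to adding
    it to both parts. *)
Lemma eqm_pconv E mu mu' nu nu' : eqm E mu mu' -> eqm E nu nu' ->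
  eqm E (pconv mu nu) (pconv mu' nu').
Proof.
have D m n : equivalent (pconv (pdirac E) (pconv m n))
    (pconv (pconv (pdirac E) m) (pconv (pdirac E) n)).
  apply: avoid_equivalent => C; rewrite !pconvE.
  have [EC|EC] := pselect (avoid C E); first by rewrite pdirac_avoid ?mul1e.
  by rewrite pdirac_hit ?mul0e.
move=> h h'; apply: equivalent_trans (D _ _) _.
apply: equivalent_trans (equivalent_sym (D _ _)).
exact: pconv_equivalent.
Qed.

Lemma eqm_ptr E K mu nu : eqm E mu nu -> eqm (cap K E) (ptr K mu) (ptr K nu).
Proof.
have D m : equivalent (ptr K (pconv (pdirac E) m)) (pconv (pdirac (cap K E)) (ptr K m)).
  apply: equivalent_trans (ptr_pconv _ _ _) _.
  apply: avoid_equivalent => C; rewrite !pconvE.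
  have E' : ptr K (pdirac E) (avoid C) = pdirac E (avoid (cap K C)) by exact: ptrE.
  have eqE : avoid (cap K C) E <-> avoid C (cap K E).
    by have /seteqP[h1 h2] := preimage_cap K C; split; [exact: h2|exact: h1].
  rewrite E'; have [EC|EC] := pselect (avoid C (cap K E)).
    by rewrite (pdirac_avoid EC) (pdirac_avoid (eqE.2 EC)).
  by rewrite (pdirac_hit EC) (pdirac_hit (fun h => EC (eqE.1 h))).
move=> h; apply: equivalent_trans (equivalent_sym (D _)) _.
apply: equivalent_trans (D _); exact: ptr_equivalent.
Qed.

Lemma eqmC E mu nu : eqm E (pconv mu nu) (pconv nu mu).
Proof. exact/equivalent_eqm/pconvC. Qed.

Lemma eqmA E mu nu la : eqm E (pconv mu (pconv nu la)) (pconv (pconv mu nu) la).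
Proof. exact/equivalent_eqm/pconvA. Qed.

Lemma eqmACA E m1 m2 m3 m4 : eqm E (pconv (pconv m1 m2) (pconv m3 m4))
  (pconv (pconv m1 m3) (pconv m2 m4)).
Proof. by apply: equivalent_eqm; apply: avoid_equivalent => C; rewrite !pconvE muleACA. Qed.

Definition splits E K L mu := eqm E mu (pconv (ptr K mu) (ptr L mu)).

Lemma splitsC E K L mu : splits E K L mu -> splits E L K mu.
Proof. by move=> h; apply: eqm_trans h (eqmC _ _ _). Qed.

Lemma splits_pconv E K L mu nu : splits E K L mu -> splits E K L nu ->
  splits E K L (pconv mu nu).
Proof.
move=> hm hn; apply: eqm_trans (eqm_pconv hm hn) _.
apply: eqm_trans (eqmACA _ _ _ _ _) _.
by apply: eqm_pconv; apply/equivalent_eqm/equivalent_sym/ptr_pconv.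
Qed.

Lemma splits_equivalent E K L mu nu : equivalent mu nu ->
  splits E K L mu -> splits E K L nu.
Proof.
move=> h hm; apply: eqm_trans (eqm_sym (equivalent_eqm E h)) _.
apply: eqm_trans hm _.
by apply: eqm_pconv; apply: equivalent_eqm; exact: ptr_equivalent.
Qed.

End equivalence_modulo.

(** * The law on a single gap, seen through windows *)

Section arc_laws.
Variable R : realType.
Local Notation T := (circle R).
Local Notation FT := (closedset (circle R)).
Implicit Types (s t x y u v a b : T) (C Z F K L E : FT) (g h : T * T).

Definition karc s t : FT := ClosedSet (@closed_carc R s t).

Lemma carc_oarc s t x : carc s t x -> [\/ oarc s t x, x = s | x = t].
Proof.
have [->|xs] := pselect (x = s); first by move=> _; apply: Or32.
have [->|xt] := pselect (x = t); first by move=> _; apply: Or33.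
move=> h; apply: Or31; move: h xs xt; clear; arc.
Qed.

Variable (Q : R.-pker (T * T)%type ~> FT).
Hypothesis Q_carried : forall s t, Q (s, t) (subsets_of_carc s t) = 1%E.
Hypothesis Q3 : forall r t s, oarc r t s ->
  equivalent (Q (r, t)) (convolution (restr_law (Q (r, t)) r s) (restr_law (Q (r, t)) s t)).

Lemma plaw_carried g (A B : FT) :
  (forall x, carc g.1 g.2 x -> cset A x <-> cset B x) ->
  plaw Q g (avoid A) = plaw Q g (avoid B).
Proof. by apply: carried_avoid; case: g => a b; exact: Q_carried. Qed.

(** The law is carried by the closed arc, and a set [C] that avoids [E] contains neither end point.
    So only the traces of the windows on the open arc count. *)
Lemma eqm_plaw E g K L : cset E g.1 -> cset E g.2 ->
  (forall x, oarc g.1 g.2 x -> cset K x <-> cset L x) ->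
  eqm E (ptr K (plaw Q g)) (ptr L (plaw Q g)).
Proof.
move=> E1 E2 KL; apply: eqm_avoid => C /avoidP EC.
have -> : ptr K (plaw Q g) (avoid C) = plaw Q g (avoid (cap K C)) by exact: ptrE.
have -> : ptr L (plaw Q g) (avoid C) = plaw Q g (avoid (cap L C)) by exact: ptrE.
apply: plaw_carried => x /carc_oarc[/KL h| |].
- by split => -[Cx /h].
- by move=> ->; split => -[/(EC _ E1)].
- by move=> ->; split => -[/(EC _ E2)].
Qed.

(** (Q3) at the interior point [u], restricted to a window [L]; [L1] and [L2] need the right trace
    on the open gap only. *)
Lemma eqm_cut E g u L L1 L2 : cset E g.1 -> cset E g.2 -> oarc g.1 g.2 u ->
  (forall x, oarc g.1 g.2 x -> cset L1 x <-> cset L x /\ carc g.1 u x) ->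
  (forall x, oarc g.1 g.2 x -> cset L2 x <-> cset L x /\ carc u g.2 x) ->
  eqm E (ptr L (plaw Q g)) (pconv (ptr L1 (plaw Q g)) (ptr L2 (plaw Q g))).
Proof.
case: g => a b /= E1 E2 gu h1 h2.
have H : equivalent (plaw Q (a, b))
  (pconv (ptr (karc a u) (plaw Q (a, b))) (ptr (karc u b) (plaw Q (a, b)))) := Q3 gu.
apply: (eqm_trans (equivalent_eqm E (ptr_equivalent L H))).
apply: (eqm_trans (equivalent_eqm E (ptr_pconv _ _ _))).
apply: eqm_pconv; apply: (eqm_trans (equivalent_eqm E (ptr_ptr _ _ _)));
  apply: eqm_plaw => //= x gx; split => [[]|].
- by move=> ? ?; apply/h1.
- by case/(h1 _ gx).
- by move=> ? ?; apply/h2.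
- by case/(h2 _ gx).
Qed.

Definition kT : FT := ClosedSet (@closedT T).

Lemma ptr_kT (mu : probability FT R) : equivalent (ptr kT mu) mu.
Proof. by apply: avoid_equivalent => C; rewrite ptrE setIT. Qed.

Lemma carc_gap_left a b s t x : oarc a b s -> ~ oarc a b t -> oarc a b x ->
  carc t s x <-> carc a s x.
Proof. by move=> h1 h2 h3; split; move: h1 h2 h3; arc. Qed.

Lemma carc_gap_right a b s t x : oarc a b s -> ~ oarc a b t -> oarc a b x ->
  carc s t x <-> carc s b x.
Proof. by move=> h1 h2 h3; split; move: h1 h2 h3; arc. Qed.

(** Here and in the lemmas up to [oarc_after] the order along the gap is a, s, t, b, with u between
    s and t where it occurs. *)
Lemma carc_gap_middle a b s t x : oarc a b s -> oarc s b t -> oarc a b x ->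
  carc s t x <-> carc s b x /\ carc a t x.
Proof.
move=> h1 h2 h3; split; first by split; move: h1 h2 h3 H; arc.
by case; move: h1 h2 h3; arc.
Qed.

Lemma carc_gap_last a b s t x : oarc a b s -> oarc s b t -> oarc a b x ->
  carc t b x <-> carc s b x /\ carc t b x.
Proof. by move=> h1 h2 h3; split=> [h|[]//]; split=> //; move: h1 h2 h3 h; arc. Qed.

Lemma carc_gap_outer_left a b s t u x : oarc a b s -> oarc s b t -> oarc s t u -> oarc a b x ->
  carc a s x <-> carc t s x /\ carc a u x.
Proof.
move=> h1 h2 h3 h4; split; first by split; move: h1 h2 h3 h4 H; arc.
by case; move: h1 h2 h3 h4; arc.
Qed.

Lemma carc_gap_outer_right a b s t u x : oarc a b s -> oarc s b t -> oarc s t u -> oarc a b x ->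
  carc t b x <-> carc t s x /\ carc u b x.
Proof.
move=> h1 h2 h3 h4; split; first by split; move: h1 h2 h3 h4 H; arc.
by case; move: h1 h2 h3 h4; arc.
Qed.

Lemma oarc_between a b s t u : oarc a b s -> oarc s b t -> oarc s t u -> oarc a b u.
Proof. arc. Qed.

Lemma oarc_after a b s t : oarc a b s -> oarc s b t -> oarc a b t.
Proof. arc. Qed.

Lemma oarc_order a b s t : oarc a b s -> oarc a b t -> s <> t ->
  ~ oarc s b t -> oarc t b s.
Proof. arc. Qed.
End arc_laws.

(** * Splitting and locality of the gap kernel *)

Section splitting.
Variable R : realType.
Local Notation T := (circle R).
Local Notation FT := (closedset (circle R)).
Implicit Types (s t x y u v a b : T) (C Z W F K L E : FT) (g h : T * T).

Lemma carcI_ends s t x : carc s t x -> carc t s x -> s <> t -> x = s \/ x = t.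
Proof.
move=> h1 h2 h3; apply: contrapT => /not_orP[h4 h5]; move: h1 h2 h3 h4 h5; arc.
Qed.

Lemma carc_cover s t x : carc s t x \/ carc t s x.
Proof.
apply: contrapT => /not_orP[h1 h2]; move: h1 h2; arc.
Qed.

Lemma carc_sub_side a b s t z x : oarc a b z -> carc s t z -> ~ oarc a b s ->
  ~ oarc a b t -> carc a b x -> carc s t x.
Proof. arc. Qed.

Variables (Q0 : probability FT R) (Q : R.-pker (T * T)%type ~> FT).
Hypothesis Q_carried : forall s t, Q (s, t) (subsets_of_carc s t) = 1%E.
Hypothesis Q3 : forall r t s, oarc r t s ->
  equivalent (Q (r, t)) (convolution (restr_law (Q (r, t)) r s) (restr_law (Q (r, t)) s t)).
Variable (q : FT -> probability FT R).
Hypothesis q_def : gap_kernel Q0 Q q.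

Lemma plaw_splits1 E g s t : cset E g.1 -> cset E g.2 ->
  oarc g.1 g.2 s -> ~ oarc g.1 g.2 t ->
  splits E (karc s t) (karc t s) (plaw Q g).
Proof.
move=> E1 E2 gs gt; apply: splitsC.
apply: (eqm_trans (equivalent_eqm E (equivalent_sym (ptr_kT _)))).
apply: (eqm_cut Q_carried Q3 E1 E2 gs) => x gx.
  by rewrite /= (carc_gap_left gs gt gx); split => // -[].
by rewrite /= (carc_gap_right gs gt gx); split => // -[].
Qed.

(** Inside the gap the arc [t,s] consists of two pieces, one at each end of the gap. Cutting at s
    and at t gives three pieces in all, and a cut at an auxiliary point [u] between s and t shows
    that the two outer ones together make up the restriction to [t,s]. *)
Lemma plaw_splits2 E g s t : cset E g.1 -> cset E g.2 ->
  oarc g.1 g.2 s -> oarc s g.2 t -> splits E (karc s t) (karc t s) (plaw Q g).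
Proof.
move=> E1 E2 gs st.
have [u su] := oarc_neq0 s t.
have gt := oarc_after gs st; have gu := oarc_between gs st su.
apply: (eqm_trans (equivalent_eqm E (equivalent_sym (ptr_kT _)))).
have H1 : eqm E (ptr (kT R) (plaw Q g))
    (pconv (ptr (karc g.1 s) (plaw Q g)) (ptr (karc s g.2) (plaw Q g))).
  by apply: (eqm_cut Q_carried Q3 E1 E2 gs) => x gx; split => // -[].
have H2 : eqm E (ptr (karc s g.2) (plaw Q g))
    (pconv (ptr (karc s t) (plaw Q g)) (ptr (karc t g.2) (plaw Q g))).
  apply: (eqm_cut Q_carried Q3 E1 E2 gt) => x gx; first exact: carc_gap_middle gs st gx.
  exact: carc_gap_last gs st gx.
have H3 : eqm E (ptr (karc t s) (plaw Q g))
    (pconv (ptr (karc g.1 s) (plaw Q g)) (ptr (karc t g.2) (plaw Q g))).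
  apply: (eqm_cut Q_carried Q3 E1 E2 gu) => x gx; first exact: carc_gap_outer_left gs st su gx.
  exact: carc_gap_outer_right gs st su gx.
apply: (eqm_trans H1).
apply: (eqm_trans (eqm_pconv (eqm_refl _ _) H2)).
apply: (eqm_trans (eqmA _ _ _ _)).
apply: (eqm_trans (eqm_pconv (eqmC _ _ _) (eqm_refl _ _))).
apply: (eqm_trans (eqm_sym (eqmA _ _ _ _))).
by apply: eqm_pconv; [exact: eqm_refl|exact: eqm_sym].
Qed.

Lemma plaw_splits E g s t : cset E g.1 -> cset E g.2 -> s <> t ->
  oarc g.1 g.2 s \/ oarc g.1 g.2 t ->
  splits E (karc s t) (karc t s) (plaw Q g).
Proof.
move=> E1 E2 st gst.
have [gs|gs] := pselect (oarc g.1 g.2 s); last first.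
  by case: gst => // gt; apply: splitsC; exact: plaw_splits1.
have [gt|gt] := pselect (oarc g.1 g.2 t); last exact: plaw_splits1.
have [sgt|sgt] := pselect (oarc s g.2 t); first exact: plaw_splits2.
apply: splitsC; apply: plaw_splits2 => //.
exact: (oarc_order gs gt st sgt).
Qed.

Lemma plaw_avoid1 g (A : FT) : (forall x, carc g.1 g.2 x -> ~ cset A x) ->
  Q g (avoid A) = 1%E.
Proof.
move=> gA; rewrite -[Q g _]/(plaw Q g (avoid A)).
rewrite (@plaw_carried _ _ Q_carried g A (ClosedSet (@closed0 T))).
  by rewrite avoid0 probability_setT.
by move=> x /gA Ax; split.
Qed.

Lemma closed_oarcC s t : closed (~` oarc s t).
Proof. by rewrite closedC; exact: open_oarc. Qed.

Definition kout g : FT := ClosedSet (@closed_oarcC g.1 g.2).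

Lemma gaps_disjoint Z g h x : gaps Z g -> gaps Z h -> g <> h -> Z <> set0 :> set T ->
  carc h.1 h.2 x -> ~ oarc g.1 g.2 x.
Proof.
move=> gg gh gnh /eqP/set0P Z0 /carc_oarc hx gx.
have [Zh1 Zh2 _] := (gapsP h (csetP Z) Z0).1 gh.
have [_ _ gZ] := (gapsP g (csetP Z) Z0).1 gg.
case: hx => [hx|xE|xE]; last 2 first.
- by apply: (gZ _ gx); rewrite xE.
- by apply: (gZ _ gx); rewrite xE.
by apply: gnh; exact: (gaps_inj (csetP Z) Z0 gg gh gx hx).
Qed.

(** Pulls one factor out of the infinite product. This is an exact identity, without adding a set:
    the end points of [g] lie in [Z] and in [K], so both sides vanish on [avoid C] if [C] contains
    one of them. *)
Lemma gap_factor Z g K : Z <> set0 :> set T -> gaps Z g ->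
  (forall x, carc g.1 g.2 x -> cset K x) ->
  equivalent (ptr K (q Z)) (pconv (ptr (cap (kout g) K) (q Z)) (plaw Q g)).
Proof.
move=> Z0 gg gK; have /eqP/set0P Z0' := Z0.
have [Zg1 Zg2 gZ] := (gapsP g (csetP Z) Z0').1 gg.
apply: avoid_equivalent => C; rewrite pconvE.
have -> : ptr K (q Z) (avoid C) = q Z (avoid (cap K C)) by exact: ptrE.
have -> : ptr (cap (kout g) K) (q Z) (avoid C) =
  q Z (avoid (cap (cap (kout g) K) C)) by exact: ptrE.
have -> : plaw Q g (avoid C) = Q g (avoid (cap K C)).
  apply: (@plaw_carried _ _ Q_carried g) => x /gK Kx; split=> [|[]//].
  by move=> Cx; split.
have AA1 : avoid (cap K C) Z <-> avoid (cap (cap (kout g) K) C) Z.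
  split => /avoidP h; apply/avoidP => x Zx.
    by case=> Cx [Kx _]; apply: (h _ Zx).
  by case=> Cx Kx; apply: (h _ Zx); split => //; split => // /gZ; exact.
apply: (gap_kernel_remove q_def Z0 gg AA1).
- move=> /avoidP ZA; apply: plaw_avoid1 => x /carc_oarc gx [Cx [Kx gnx]].
  by case: gx => [//|xE|xE]; apply: (ZA x); rewrite ?xE //; split; rewrite -xE.
- move=> _ h gh hg; apply: (@plaw_carried _ _ Q_carried h) => x hx.
  split=> [[Cx Kx]|[Cx [Kx _]]//]; split => //; split => //.
  by apply: (gaps_disjoint gg gh _ Z0 hx) => gE; exact: hg.
Qed.

(** Once the gaps around s and t are cut out by [K], every other gap lies within one of the two
    arcs, so its factor goes to that side and the other side receives 1. *)
Lemma gap_splits0 Z s t K : Z <> set0 :> set T -> s <> t ->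
  (forall g, gaps Z g -> oarc g.1 g.2 s \/ oarc g.1 g.2 t ->
    forall x, cset K x -> ~ oarc g.1 g.2 x) ->
  equivalent (ptr K (q Z))
    (pconv (ptr (karc s t) (ptr K (q Z))) (ptr (karc t s) (ptr K (q Z)))).
Proof.
move=> Z0 st hK; have /eqP/set0P Z0' := Z0.
apply: avoid_equivalent => C; rewrite pconvE.
have -> : ptr K (q Z) (avoid C) = q Z (avoid (cap K C)) by exact: ptrE.
have E L : ptr L (ptr K (q Z)) (avoid C) = q Z (avoid (cap K (cap L C))).
  by transitivity (ptr K (q Z) (avoid (cap L C))); exact: ptrE.
rewrite !E; apply: (gap_kernel_mul q_def Z0).
  split=> [/avoidP h|[/avoidP h1 /avoidP h2]].
    by split; apply/avoidP => x Zx [[Cx _] Kx]; apply: (h _ Zx).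
  apply/avoidP => x Zx [Cx Kx].
  by case: (carc_cover s t x) => ?; [apply: (h1 _ Zx)|apply: (h2 _ Zx)].
move=> /avoidP ZA g gg.
have [Zg1 Zg2 gZ] := (gapsP g (csetP Z) Z0').1 gg.
(* The ends of a gap lie in [Z], which misses [C] within [K]; so on the closed gap only interior
   points matter. *)
have edge x : carc g.1 g.2 x -> cset C x -> cset K x -> oarc g.1 g.2 x.
  by move=> /carc_oarc[//|xE|xE] Cx Kx; exfalso; apply: (ZA x); rewrite ?xE // -xE.
have [gst|/not_orP[gs gt]] := pselect (oarc g.1 g.2 s \/ oarc g.1 g.2 t).
  rewrite !plaw_avoid1 ?mule1 // => x gx.
  - by case=> [[Cx _] Kx]; apply: (hK _ gg gst _ Kx); exact: edge.
  - by case=> [[Cx _] Kx]; apply: (hK _ gg gst _ Kx); exact: edge.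
  - by case=> [Cx Kx]; apply: (hK _ gg gst _ Kx); exact: edge.
have [z gz] := oarc_neq0 g.1 g.2.
have side u v : (u = s /\ v = t) \/ (u = t /\ v = s) -> carc u v z ->
    Q g (avoid (cap K C)) = Q g (avoid (cap K (cap (karc u v) C))) /\
    Q g (avoid (cap K (cap (karc v u) C))) = 1%E.
  move=> uv uvz.
  have gu : ~ oarc g.1 g.2 u by case: uv => -[-> _].
  have gv : ~ oarc g.1 g.2 v by case: uv => -[_ ->].
  have unv : u <> v by case: uv => -[-> ->] // /esym.
  have sub x : carc g.1 g.2 x -> carc u v x := carc_sub_side gz uvz gu gv.
  split.
    apply: (@plaw_carried _ _ Q_carried g) => x /sub ux.
    by split=> [[Cx Kx]|[[Cx _] Kx]].
  apply: plaw_avoid1 => x gx [[Cx vux] Kx].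
  have ogx := edge _ gx Cx Kx.
  by case: (carcI_ends (sub _ gx) vux unv) => xE; [apply: gu|apply: gv]; rewrite -xE.
case: (carc_cover s t z) => hz.
  by have [-> ->] := side s t (or_introl (conj erefl erefl)) hz; rewrite mule1.
by have [-> ->] := side t s (or_intror (conj erefl erefl)) hz; rewrite mul1e.
Qed.

Lemma gap_kernel_absorbs Z : Z <> set0 :> set T -> absorbs Z (q Z).
Proof. by move=> Z0 C ZC; exact: (gap_kernel_hit q_def Z0 ZC). Qed.

Lemma gap_kernel_splits Z s t : Z <> set0 :> set T -> s <> t ->
  ~ cset Z s -> ~ cset Z t ->
  equivalent (q Z) (pconv (ptr (karc s t) (q Z)) (ptr (karc t s) (q Z))).
Proof.
move=> Z0 st Zs Zt; have /eqP/set0P Z0' := Z0.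
(* Both laws contain [Z] almost surely, so it suffices to compare them modulo [Z], where the end
   points of all gaps are harmless. *)
apply: (@eqm_absorbs _ Z).
- exact: gap_kernel_absorbs.
- move=> C ZC; rewrite pconvE.
  have E L : ptr L (q Z) (avoid C) = q Z (avoid (cap L C)) by exact: ptrE.
  rewrite !E.
  have [h1|h1] := pselect (avoid (cap (karc s t) C) Z); last first.
    by rewrite (gap_kernel_hit q_def Z0 h1) mul0e.
  have [h2|h2] := pselect (avoid (cap (karc t s) C) Z); last first.
    by rewrite (gap_kernel_hit q_def Z0 h2) mule0.
  exfalso; apply: ZC; move/avoidP: h1 => h1; move/avoidP: h2 => h2.
  apply/avoidP => x Zx Cx.
  by case: (carc_cover s t x) => ?; [apply: (h1 _ Zx)|apply: (h2 _ Zx)].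
have gs := gaps_gap (csetP Z) Z0' Zs; have gt := gaps_gap (csetP Z) Z0' Zt.
have [_ _ gss _] := gapP (csetP Z) Z0' Zs.
have [_ _ gtt _] := gapP (csetP Z) Z0' Zt.
move: gs gt gss gtt; set g := gap s Z; set h := gap t Z => gg gh gs ht.
have [Zg1 Zg2 gZ] := (gapsP g (csetP Z) Z0').1 gg.
have [Zh1 Zh2 hZ] := (gapsP h (csetP Z) Z0').1 gh.
apply: splits_equivalent (ptr_kT (q Z)) _.
apply: splits_equivalent (equivalent_sym (gap_factor Z0 gg _)) _ => //.
have Qg : splits Z (karc s t) (karc t s) (plaw Q g).
  by apply: plaw_splits => //; left.
have Qh : splits Z (karc s t) (karc t s) (plaw Q h).
  by apply: plaw_splits => //; right.
have gap_s k : gaps Z k -> oarc k.1 k.2 s -> k = g.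
  by move=> gk ks; exact: (gaps_inj (csetP Z) Z0' gk gg ks gs).
have gap_t k : gaps Z k -> oarc k.1 k.2 t -> k = h.
  by move=> gk kt; exact: (gaps_inj (csetP Z) Z0' gk gh kt ht).
apply: splits_pconv => //.
(* If s and t share their gap, its factor is already pulled out; otherwise the gap around t must be
   pulled out as well. *)
have [gh'|gh'] := pselect (g = h).
  apply: equivalent_eqm; apply: gap_splits0 => // k gk kst x [_ gx].
  suff -> : k = g by [].
  by case: kst => [/gap_s|/gap_t]; rewrite -?gh'; exact.
apply: splits_equivalent (equivalent_sym (gap_factor Z0 gh _)) _.
  by move=> x hx; split => //; exact: (gaps_disjoint gg gh gh' Z0 hx).
apply: splits_pconv => //.
apply: equivalent_eqm; apply: gap_splits0 => // k gk kst x [[_ gx] hx].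
by case: kst => [/(gap_s _ gk) ->|/(gap_t _ gk) ->].
Qed.

End splitting.

(** * Locality: the class of the restriction to [s,t] depends only on the trace of Z there *)

Section locality.
Variable R : realType.
Local Notation T := (circle R).
Local Notation FT := (closedset (circle R)).
Implicit Types (s t x y u v a b : T) (C Z W F K L E N : FT) (g h : T * T).

Lemma carc_endl s t : carc s t s.
Proof. arc. Qed.

Lemma carc_endr s t : carc s t t.
Proof. arc. Qed.

Lemma carc_gap_endr a b s t x : carc s t x -> ~ oarc a b x -> oarc a b s -> carc s t b.
Proof. arc. Qed.

Lemma carc_gap_endl a b s t x : carc s t x -> ~ oarc a b x -> oarc a b t -> carc s t a.
Proof. arc. Qed.

Lemma carc_sub_oarc a b s t x : oarc a b s -> ~ carc s t a -> ~ carc s t b ->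
  carc s t x -> oarc a b x.
Proof. arc. Qed.

Lemma gap_endr_inj a b a' b' s : oarc a b s -> oarc a' b' s ->
  ~ oarc a b b' -> ~ oarc a' b' b -> b = b'.
Proof. arc. Qed.

Lemma gap_endl_inj a b a' b' s : oarc a b s -> oarc a' b' s ->
  ~ oarc a b a' -> ~ oarc a' b' a -> a = a'.
Proof. arc. Qed.

Lemma gap_exclude_left a b a' c c' s t x : oarc a b s -> oarc a' b s -> oarc c c' t ->
  carc s t b -> carc s t c -> ~ oarc a' b c -> carc s t x ->
  ~ oarc a b x -> ~ oarc c c' x -> ~ oarc a' b x.
Proof. arc. Qed.

Lemma gap_exclude_right a b c c' d s t x : oarc a b s -> oarc c c' t -> oarc c d t ->
  carc s t b -> carc s t c -> ~ oarc c d b -> carc s t x ->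
  ~ oarc a b x -> ~ oarc c c' x -> ~ oarc c d x.
Proof. arc. Qed.

Lemma oarc_wrap a b s t : s <> t -> oarc a b s -> oarc a b t -> carc s t b -> oarc t b s.
Proof. arc. Qed.

Variables (Q0 : probability FT R) (Q : R.-pker (T * T)%type ~> FT).
Hypothesis Q_carried : forall s t, Q (s, t) (subsets_of_carc s t) = 1%E.
Hypothesis Q2 : forall r r' s t t',
  (oarc r t `&` oarc r t' `&` oarc r' t `&` oarc r' t') s ->
  equivalent (restr_law (Q (r, t)) r s) (restr_law (Q (r, t')) r s) /\
  equivalent (restr_law (Q (r, t)) s t) (restr_law (Q (r', t)) s t).
Hypothesis Q3 : forall r t s, oarc r t s ->
  equivalent (Q (r, t)) (convolution (restr_law (Q (r, t)) r s) (restr_law (Q (r, t)) s t)).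
Hypothesis Q4 : forall r s s' t, carc s s' `<=` oarc r t ->
  equivalent (restr_law (Q (r, t)) s s') (restr_law Q0 s s').
Variable (q : FT -> probability FT R).
Hypothesis q_def : gap_kernel Q0 Q q.

(** For nonempty [Z] the whole arc [s,t] lies in one gap, whose law (Q4) compares with [Q0]; for
    empty [Z] the law is [Q0] itself. All sets with empty trace thus lead to the same class. *)
Lemma gap_kernel_local0 Z s t : avoid (carc s t) Z ->
  equivalent (ptr (karc s t) (q Z)) (ptr (karc s t) Q0).
Proof.
move=> Zst; have [Z0|Z0] := pselect (Z = set0 :> set T).
  by apply: ptr_equivalent; apply: same_equivalent; exact: (q_def Z).1 Z0.
move/avoidP: Zst => Zst; have /eqP/set0P Z0' := Z0.
have ss := carc_endl s t.
have Zs : ~ cset Z s by move/Zst; exact.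
have gg := gaps_gap (csetP Z) Z0' Zs; have [_ _ gs _] := gapP (csetP Z) Z0' Zs.
move: gg gs; set g := gap s Z => gg gs.
have [Zg1 Zg2 gZ] := (gapsP g (csetP Z) Z0').1 gg.
have sub x : carc s t x -> oarc g.1 g.2 x := carc_sub_oarc gs (Zst _ Zg1) (Zst _ Zg2).
apply: (@equivalent_trans _ _ _ _ (ptr (karc s t) (plaw Q g))); last first.
  have H : equivalent (restr_law (Q (g.1, g.2)) s t) (restr_law Q0 s t) := Q4 sub.
  by move: H; rewrite -surjective_pairing.
apply: avoid_equivalent => C.
have -> : ptr (karc s t) (q Z) (avoid C) = q Z (avoid (cap (karc s t) C)) by exact: ptrE.
have -> : ptr (karc s t) (plaw Q g) (avoid C) = Q g (avoid (cap (karc s t) C)) by exact: ptrE.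
have av0 F : avoid (ClosedSet (@closed0 T)) F by rewrite /avoid /= setI0.
(* With the empty set as the remaining part, all gaps other than [g] contribute 1. *)
rewrite (@gap_kernel_remove _ Q0 Q q q_def Z _ (ClosedSet (@closed0 T)) g Z0 gg).
- by rewrite avoid0 probability_setT mul1e.
- by split => // _; apply/avoidP => x /Zst Zx [_ /Zx].
- by move=> _; apply: (plaw_avoid1 Q_carried) => x _ [].
- move=> _ h gh hg; apply: (@plaw_carried _ _ Q_carried h) => x hx; split => // -[_ /sub gx].
  by apply: (gaps_disjoint gg gh _ Z0 hx gx) => gE; exact: hg.
Qed.

Lemma ptr_ext K L (mu : probability FT R) : (forall x, cset K x <-> cset L x) ->
  equivalent (ptr K mu) (ptr L mu).
Proof.
move=> KL; suff -> : K = L by exact: equivalent_refl.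
case: K L KL => K cK [L cL] /= KL.
have KE : K = L by apply/seteqP; split => x /KL.
by move: cK; rewrite KE => cK; congr ClosedSet; exact: Prop_irrelevance.
Qed.

Lemma kout_closed (g h : T * T) s t :
  closed (carc s t `&` (~` oarc g.1 g.2 `&` ~` oarc h.1 h.2)).
Proof.
apply: closedI; first exact: closed_carc.
by apply: closedI; exact: closed_oarcC.
Qed.

Definition kinner g h s t : FT := ClosedSet (@kout_closed g h s t).

(** A normal form for the restriction to [s,t]: the inner part, free of the gaps around s and t, and
    the two pieces of these gaps that reach into [s,t]. [E] may exceed [Z], so that two sets can be
    treated modulo the same [E]. *)
Lemma gap_kernel_normal Z E s t g h : Z <> set0 :> set T -> s <> t ->
  (forall x, cset Z x -> cset E x) -> gaps Z g -> gaps Z h ->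
  oarc g.1 g.2 s -> oarc h.1 h.2 t -> carc s t g.2 -> carc s t h.1 ->
  eqm E (ptr (karc s t) (q Z)) (pconv (ptr (kinner g h s t) (q Z))
    (pconv (ptr (karc s g.2) (plaw Q g)) (ptr (karc h.1 t) (plaw Q h)))).
Proof.
move=> Z0 st ZE gg gh gs ht sg sh; have /eqP/set0P Z0' := Z0.
have [Zg1 Zg2 gZ] := (gapsP g (csetP Z) Z0').1 gg.
have [Zh1 Zh2 hZ] := (gapsP h (csetP Z) Z0').1 gh.
have fg := gap_factor Q_carried q_def (K := kT R) Z0 gg (fun _ _ => I).
have H0 := equivalent_trans (equivalent_sym (ptr_kT (q Z))) fg.
(* If one gap contains both ends, then t precedes s in it, and [s,t] meets it in two pieces; a cut
   at a point between t and s separates them. *)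
have [gh'|gh'] := pselect (g = h).
  have H1 := equivalent_trans (ptr_equivalent (karc s t) H0) (ptr_pconv _ _ _).
  apply: (eqm_trans (equivalent_eqm E H1)); apply: eqm_pconv.
    apply: equivalent_eqm; apply: equivalent_trans (ptr_ptr _ _ _) _.
    by apply: ptr_ext => x; rewrite /= -gh'; split=> [[? []]|[? []]].
  rewrite -gh'; rewrite -gh' in ht sh.
  have [u tu] := oarc_neq0 t s.
  have ts := oarc_wrap st gs ht sg.
  have gu := oarc_between ht ts tu.
  apply: (eqm_trans _ (eqmC _ _ _)).
  apply: (eqm_cut Q_carried Q3 _ _ gu); [exact: ZE|exact: ZE| |] => x gx.
    exact: carc_gap_outer_left ht ts tu gx.
  exact: carc_gap_outer_right ht ts tu gx.
have fh := gap_factor Q_carried q_def (K := cap (kout g) (kT R)) Z0 gh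
  (fun x hx => conj I (gaps_disjoint gg gh gh' Z0 hx)).
have H1 := equivalent_trans H0 (pconv_equivalent fh (equivalent_refl (plaw Q g))).
have H2 := equivalent_trans (ptr_equivalent (karc s t) H1) (ptr_pconv _ _ _).
have H3 := equivalent_trans H2 (pconv_equivalent (ptr_pconv _ _ _) (equivalent_refl _)).
apply: (eqm_trans (equivalent_eqm E H3)).
apply: (eqm_trans (eqm_sym (eqmA _ _ _ _))); apply: eqm_pconv.
  apply: equivalent_eqm; apply: equivalent_trans (ptr_ptr _ _ _) _.
  by apply: ptr_ext => x; split=> [[? [[_ ?] ?]]|[? []]]; split.
have gt : ~ oarc g.1 g.2 t.
  by move=> gt; apply: gh'; exact: (gaps_inj (csetP Z) Z0' gg gh gt ht).
have hs : ~ oarc h.1 h.2 s.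
  by move=> hs; apply: gh'; exact: (gaps_inj (csetP Z) Z0' gg gh gs hs).
apply: (eqm_trans (eqmC _ _ _)); apply: eqm_pconv;
  apply: (eqm_plaw Q_carried); try exact: ZE.
- by move=> x gx; exact: (carc_gap_right gs gt gx).
- by move=> x hx; exact: (carc_gap_left ht hs hx).
Qed.

End locality.

Section locality_main.
Variable R : realType.
Local Notation T := (circle R).
Local Notation FT := (closedset (circle R)).
Implicit Types (s t x y u v a b : T) (C Z W F K L E N : FT) (g h : T * T).

Variables (Q0 : probability FT R) (Q : R.-pker (T * T)%type ~> FT).
Hypothesis Q_carried : forall s t, Q (s, t) (subsets_of_carc s t) = 1%E.
Hypothesis Q2 : forall r r' s t t',
  (oarc r t `&` oarc r t' `&` oarc r' t `&` oarc r' t') s ->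
  equivalent (restr_law (Q (r, t)) r s) (restr_law (Q (r, t')) r s) /\
  equivalent (restr_law (Q (r, t)) s t) (restr_law (Q (r', t)) s t).
Hypothesis Q3 : forall r t s, oarc r t s ->
  equivalent (Q (r, t)) (convolution (restr_law (Q (r, t)) r s) (restr_law (Q (r, t)) s t)).
Hypothesis Q4 : forall r s s' t, carc s s' `<=` oarc r t ->
  equivalent (restr_law (Q (r, t)) s s') (restr_law Q0 s s').
Variable (q : FT -> probability FT R).
Hypothesis q_def : gap_kernel Q0 Q q.

(** A gap of [Z] that contains neither s nor t lies within [s,t] or within [t,s]. In the first case
    it is a gap of [W] too, with the same least dense index; in the second it touches [N] at most at
    s or t, which it does not contain. *)
Lemma gap_enum_local Z W N s t k g : Z <> set0 :> set T -> W <> set0 :> set T ->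
  s <> t -> ~ cset Z s ->
  (forall x, carc s t x -> cset Z x <-> cset W x) ->
  (forall x, cset N x -> carc s t x) ->
  (forall g, gaps Z g -> oarc g.1 g.2 s \/ oarc g.1 g.2 t ->
    forall x, cset N x -> ~ oarc g.1 g.2 x) ->
  ~ cset Z t -> avoid N Z -> gap_enum Z k = Some g ->
  Q g (avoid N) = 1%E \/ gap_enum W k = Some g.
Proof.
move=> Z0 W0 st Zs ZW Nst Nout Zt /avoidP ZN.
have /eqP/set0P Z0' := Z0; have /eqP/set0P W0' := W0.
rewrite {1}/gap_enum; case: asboolP => // -[Zk hk] [gE].
have gg : gaps Z g by rewrite -gE; exact: gaps_gap (csetP Z) Z0' Zk.
have gk : oarc g.1 g.2 (rpt R k) by rewrite -gE; case: (gapP (csetP Z) Z0' Zk).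
have [Zg1 Zg2 gZ] := (gapsP g (csetP Z) Z0').1 gg.
have edge x : carc g.1 g.2 x -> cset N x -> oarc g.1 g.2 x.
  by move=> /carc_oarc[//|xE|xE] Nx; exfalso; apply: (ZN x); rewrite ?xE // -xE.
have [gst|/not_orP[gs gt]] := pselect (oarc g.1 g.2 s \/ oarc g.1 g.2 t).
  left; apply: (plaw_avoid1 Q_carried) => x gx Nx.
  by apply: (Nout _ gg gst _ Nx); exact: edge.
case: (carc_cover s t (rpt R k)) => kst; last first.
  left; apply: (plaw_avoid1 Q_carried) => x gx Nx.
  have tsx := carc_sub_side gk kst gt gs gx.
  have ogx := edge _ gx Nx.
  by case: (carcI_ends (Nst _ Nx) tsx st) => xE; [apply: gs|apply: gt]; rewrite -xE.
right.
have sub x : carc g.1 g.2 x -> carc s t x := carc_sub_side gk kst gs gt.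
have Wk : ~ cset W (rpt R k) by move/(ZW _ kst).
have gW : gaps W g.
  apply/(gapsP g (csetP W) W0'); split.
  - by apply/ZW => //; apply: sub; exact: carc_endl.
  - by apply/ZW => //; apply: sub; exact: carc_endr.
  - by move=> x gx /(ZW _ (sub _ (oarc_carc gx))); exact: gZ.
have WE := gap_eq (csetP W) W0' gW gk.
rewrite /gap_enum; case: asboolP => [_|]; first by rewrite WE.
case; split => // m mk /(same_gapP _ W0 Wk); rewrite WE => gm.
by apply: (hk _ mk); apply/(same_gapP _ Z0 Zk); rewrite gE.
Qed.

Lemma gap_kernel_inner Z W N s t : Z <> set0 :> set T -> W <> set0 :> set T ->
  s <> t -> ~ cset Z s -> ~ cset Z t -> ~ cset W s -> ~ cset W t ->
  (forall x, carc s t x -> cset Z x <-> cset W x) ->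
  (forall x, cset N x -> carc s t x) ->
  (forall g, gaps Z g -> oarc g.1 g.2 s \/ oarc g.1 g.2 t ->
    forall x, cset N x -> ~ oarc g.1 g.2 x) ->
  (forall g, gaps W g -> oarc g.1 g.2 s \/ oarc g.1 g.2 t ->
    forall x, cset N x -> ~ oarc g.1 g.2 x) ->
  equivalent (ptr N (q Z)) (ptr N (q W)).
Proof.
move=> Z0 W0 st Zs Zt Ws Wt ZW Nst NZ NW.
apply: avoid_equivalent => C.
have -> : ptr N (q Z) (avoid C) = q Z (avoid (cap N C)) by exact: ptrE.
have -> : ptr N (q W) (avoid C) = q W (avoid (cap N C)) by exact: ptrE.
have avZW : avoid (cap N C) Z <-> avoid (cap N C) W.
  by split=> /avoidP h; apply/avoidP => x Zx [Cx Nx];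
    apply: (h x) => //; apply/(ZW _ (Nst _ Nx)).
have [ZA|ZA] := pselect (avoid (cap N C) Z); last first.
  by rewrite (gap_kernel_hit q_def Z0 ZA) (gap_kernel_hit q_def W0) // => /avZW.
have WA := avZW.1 ZA.
have WZ x : carc s t x -> cset W x <-> cset Z x by move=> /ZW[].
rewrite [LHS]probability_avoid [RHS]probability_avoid; congr EFin.
rewrite -(cvg_lim (@Rhausdorff R) (gap_kernel_cvg q_def Z0 (gap_enumP Z0) ZA)).
rewrite -(cvg_lim (@Rhausdorff R) (gap_kernel_cvg q_def W0 (gap_enumP W0) WA)).
congr (lim (_ @ \oo)); apply/funext => n; apply: eq_bigr => k _.
have Nst' x : cset (cap N C) x -> carc s t x by move=> [_ /Nst].
have NZ' g : gaps Z g -> oarc g.1 g.2 s \/ oarc g.1 g.2 t ->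
    forall x, cset (cap N C) x -> ~ oarc g.1 g.2 x.
  by move=> gg gst x [_ Nx]; exact: NZ gst _ Nx.
have NW' g : gaps W g -> oarc g.1 g.2 s \/ oarc g.1 g.2 t ->
    forall x, cset (cap N C) x -> ~ oarc g.1 g.2 x.
  by move=> gg gst x [_ Nx]; exact: NW gst _ Nx.
case Zk: (gap_enum Z k) => [g|] /=.
  have [Qg|->//] := gap_enum_local Z0 W0 st Zs ZW Nst' NZ' Zt ZA Zk.
  case Wk: (gap_enum W k) => [h|] /=; last by rewrite Qg.
  have [Qh|hk] := gap_enum_local W0 Z0 st Ws WZ Nst' NW' Wt WA Wk.
    by rewrite Qg Qh.
  by move: hk; rewrite Zk => -[->].
case Wk: (gap_enum W k) => [h|] //=.
have [->//|] := gap_enum_local W0 Z0 st Ws WZ Nst' NW' Wt WA Wk.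
by rewrite Zk.
Qed.

Lemma gap_kernel_local Z W s t : s <> t ->
  ~ cset Z s -> ~ cset Z t -> ~ cset W s -> ~ cset W t ->
  (forall x, carc s t x -> cset Z x <-> cset W x) ->
  equivalent (ptr (karc s t) (q Z)) (ptr (karc s t) (q W)).
Proof.
move=> st Zs Zt Ws Wt ZW.
have [Zst|/avoidP/existsNP[x /not_implyP[Zx /contrapT xst]]] := pselect (avoid (carc s t) Z).
  have Wst : avoid (carc s t) W.
    by move/avoidP: Zst => Zst; apply/avoidP => x Wx xst; apply: (Zst x) => //; apply/ZW.
  apply: equivalent_trans (gap_kernel_local0 Q_carried Q4 q_def Zst) _.
  exact: equivalent_sym (gap_kernel_local0 Q_carried Q4 q_def Wst).
have Wx : cset W x by apply/ZW.
have Z0' : cset Z !=set0 by exists x.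
have W0' : cset W !=set0 by exists x.
have Z0 : Z <> set0 :> set T by apply/eqP/set0P.
have W0 : W <> set0 :> set T by apply/eqP/set0P.
have gg := gaps_gap (csetP Z) Z0' Zs; have gh := gaps_gap (csetP Z) Z0' Zt.
have kg := gaps_gap (csetP W) W0' Ws; have kh := gaps_gap (csetP W) W0' Wt.
have [_ _ gs _] := gapP (csetP Z) Z0' Zs; have [_ _ ht _] := gapP (csetP Z) Z0' Zt.
have [_ _ gs' _] := gapP (csetP W) W0' Ws; have [_ _ ht' _] := gapP (csetP W) W0' Wt.
move: gg gh kg kh gs ht gs' ht'.
move: (gap s Z) (gap t Z) (gap s W) (gap t W) => g h g' h' gg gh kg kh gs ht gs' ht'.
have [Zg1 Zg2 gZ] := (gapsP g (csetP Z) Z0').1 gg.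
have [Zh1 Zh2 hZ] := (gapsP h (csetP Z) Z0').1 gh.
have [Wg1 Wg2 gW] := (gapsP g' (csetP W) W0').1 kg.
have [Wh1 Wh2 hW] := (gapsP h' (csetP W) W0').1 kh.
have sg : carc s t g.2.
  by apply: (carc_gap_endr xst _ gs) => /gZ; exact.
have sg' : carc s t g'.2.
  by apply: (carc_gap_endr xst _ gs') => /gW; exact.
have sh : carc s t h.1.
  by apply: (carc_gap_endl xst _ ht) => /hZ; exact.
have sh' : carc s t h'.1.
  by apply: (carc_gap_endl xst _ ht') => /hW; exact.
(* The ends that lie in [s,t] belong to the common trace and hence coincide; only the far ends of
   these gaps may differ. *)
have Eg : g.2 = g'.2.
  apply: (gap_endr_inj gs gs'); first by move/gZ; apply; exact/ZW.
  by move/gW; apply; exact/ZW.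
have Eh : h.1 = h'.1.
  apply: (gap_endl_inj ht ht'); first by move/hZ; apply; exact/ZW.
  by move/hW; apply; exact/ZW.
case: g g' h h' => [a b] [a' b'] [c d] [c' d'] /= in
  gg gh kg kh gs ht gs' ht' Zg1 Zg2 gZ Zh1 Zh2 hZ Wg1 Wg2 gW Wh1 Wh2 hW
  sg sg' sh sh' Eg Eh *.
subst b' c'.
(* The far ends belong to different sets, so both sets are added. *)
pose E := csetU Z W.
have ZE y : cset Z y -> cset E y by left.
have WE y : cset W y -> cset E y by right.
have HZ := gap_kernel_normal Q_carried Q3 q_def Z0 st ZE gg gh gs ht sg sh.
have HW := gap_kernel_normal Q_carried Q3 q_def W0 st WE kg kh gs' ht' sg sh.
have cZ y : carc s t y -> ~ oarc a b y -> ~ oarc c d y ->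
    ~ oarc a' b y /\ ~ oarc c d' y.
  move=> sty nab ncd; split.
    by apply: (gap_exclude_left gs gs' ht sg sh _ sty nab ncd) => /gW; apply; exact/ZW.
  by apply: (gap_exclude_right gs ht ht' sg sh _ sty nab ncd) => /hW; apply; exact/ZW.
have cW y : carc s t y -> ~ oarc a' b y -> ~ oarc c d' y ->
    ~ oarc a b y /\ ~ oarc c d y.
  move=> sty nab ncd; split.
    by apply: (gap_exclude_left gs' gs ht' sg sh _ sty nab ncd) => /gZ; apply; exact/ZW.
  by apply: (gap_exclude_right gs' ht' ht sg sh _ sty nab ncd) => /hZ; apply; exact/ZW.
have NE : equivalent (ptr (kinner (a', b) (c, d') s t) (q W))
                     (ptr (kinner (a, b) (c, d) s t) (q W)).
  by apply: ptr_ext => y; split=> -[sty [/= n1 n2]]; split => //;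
    [have [] := cW y sty n1 n2|have [] := cZ y sty n1 n2].
have gap_s V k k' : cset V !=set0 -> gaps V k -> gaps V k' -> oarc k.1 k.2 s ->
    oarc k'.1 k'.2 s -> k' = k.
  by move=> V0 h1 h2 h3 h4; exact: (gaps_inj (csetP V) V0 h2 h1 h4 h3).
have gap_t V k k' : cset V !=set0 -> gaps V k -> gaps V k' -> oarc k.1 k.2 t ->
    oarc k'.1 k'.2 t -> k' = k.
  by move=> V0 h1 h2 h3 h4; exact: (gaps_inj (csetP V) V0 h2 h1 h4 h3).
have NZW : equivalent (ptr (kinner (a, b) (c, d) s t) (q Z))
                      (ptr (kinner (a, b) (c, d) s t) (q W)).
  apply: (gap_kernel_inner Z0 W0 st Zs Zt Ws Wt ZW) => [y []//||].
    move=> k gk kst y [sty [/= n1 n2]]; case: kst => [ks|kt].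
      by rewrite (gap_s _ _ _ Z0' gg gk gs ks).
    by rewrite (gap_t _ _ _ Z0' gh gk ht kt).
  move=> k gk kst y [sty [/= n1 n2]]; have [m1 m2] := cZ y sty n1 n2.
  case: kst => [ks|kt].
    by rewrite (gap_s _ _ _ W0' kg gk gs' ks).
  by rewrite (gap_t _ _ _ W0' kh gk ht' kt).
(* (Q2) makes the class of the piece inside [s,t] independent of the far end of the gap. *)
have H1 : equivalent (ptr (karc s b) (plaw Q (a, b))) (ptr (karc s b) (plaw Q (a', b))).
  by have [] := @Q2 a a' s b b (conj (conj (conj gs gs) gs') gs').
have H2 : equivalent (ptr (karc c t) (plaw Q (c, d))) (ptr (karc c t) (plaw Q (c, d'))).
  by have [] := @Q2 c c t d d' (conj (conj (conj ht ht') ht) ht').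
have H : eqm E (ptr (karc s t) (q Z)) (ptr (karc s t) (q W)).
  apply: (eqm_trans HZ); apply: (eqm_trans _ (eqm_sym HW)).
  apply: eqm_pconv.
    by apply: equivalent_eqm; apply: (equivalent_trans NZW); exact: equivalent_sym.
  by apply: eqm_pconv; exact: equivalent_eqm.
(* Within [s,t] the set [E] is just the common trace. A second restriction to [s,t], which does not
   change the laws, replaces [E] by this trace, which both laws absorb. *)
have abs V : cset V !=set0 -> (forall y, carc s t y -> cset E y -> cset V y) ->
    absorbs (cap (karc s t) E) (ptr (karc s t) (ptr (karc s t) (q V))).
  move=> V0 VE C EC.
  have -> : ptr (karc s t) (ptr (karc s t) (q V)) (avoid C) =
      q V (avoid (cap (karc s t) (cap (karc s t) C))).
    by transitivity (ptr (karc s t) (q V) (avoid (cap (karc s t) C))); exact: ptrE.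
  apply: (gap_kernel_hit q_def); first by apply/eqP/set0P.
  move=> /avoidP VC; apply: EC; apply/avoidP => y [Ey sty] Cy.
  by apply: (VC y); [exact: VE|split].
have idem V : equivalent (ptr (karc s t) (ptr (karc s t) (q V))) (ptr (karc s t) (q V)).
  by apply: (equivalent_trans (ptr_ptr _ _ _)); apply: ptr_ext => y; split=> [[]|].
apply: (equivalent_trans (equivalent_sym (idem Z))).
apply: (equivalent_trans _ (idem W)).
apply: (@eqm_absorbs _ (cap (karc s t) E)).
- by apply: abs => // y sty [//|Wy]; apply/ZW.
- by apply: abs => // y sty [Zy|//]; apply/ZW.
- exact: eqm_ptr.
Qed.

End locality_main.

(** * The zero-one law for hitting a point *)

Section disjoint_events.
Context d (S : measurableType d) (R : realType) (P : probability S R).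

(** At most n + 1 disjoint events have probability at least 1/(n + 1); the union over n is
    countable. *)
Lemma countable_disjoint_events (I : choiceType) (A : I -> set S) :
  (forall i, measurable (A i)) -> (forall i j x, A i x -> A j x -> i = j) ->
  countable [set i | P (A i) != 0%E].
Proof.
move=> mA Ainj.
rewrite (_ : [set i | _] = \bigcup_n [set i | ((n.+1%:R^-1)%:E <= P (A i))%E]); last first.
  apply/seteqP; split => [i /= Ai|i [n _ /= Ai]]; last first.
    by rewrite gt_eqF //; apply: lt_le_trans Ai; rewrite lte_fin invr_gt0.
  have : (0 < fine (P (A i)))%R.
    rewrite fine_gt0 // lt_neqAle eq_sym Ai measure_ge0 /=.
    by rewrite ltey_eq fin_num_measure.
  move=> /[dup] p0; rewrite -invr_gt0 => /ltW/archi_boundP.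
  set n := Num.bound _ => pn; exists n => //=.
  rewrite -(@fineK _ (P (A i))) ?fin_num_measure // lee_fin.
  rewrite -[leRHS]invrK lef_pV2 ?posrE ?invr_gt0 //.
  by apply: (le_trans (ltW pn)); rewrite ler_nat.
apply: bigcup_countable => // n _; apply: finite_set_countable.
apply: contrapT => /(infinite_set_fset n.+2)[B BA Bn].
have : (P (\big[setU/set0]_(i <- B) A i) <= 1)%E.
  by apply: probability_le1; apply: bigsetU_measurable.
rewrite measure_fbigsetU //; last first.
  by apply/trivIsetP => i j _ _ ij; apply/seteqP; split => // x [Ai Aj];
     move/eqP: ij; apply; exact: Ainj Ai Aj.
apply/negP; rewrite -ltNge.
apply: (@lt_le_trans _ _ (\sum_(i <- B) (n.+1%:R^-1)%:E)%E).
  rewrite sumEFin lte_fin big_const_seq count_predT iter_addr_0.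
  rewrite -[X in _ < X]mulr_natl ltr_pdivlMr // mul1r ltr_nat.
  by apply: leq_trans Bn.
rewrite big_seq [leRHS]big_seq; apply: lee_sum => i iB.
exact: BA.
Qed.

End disjoint_events.

Section zero_one.
Variable R : realType.
Local Notation T := (circle R).
Local Notation FT := (closedset (circle R)).
Implicit Types (s t x y u v a b : T) (C Z W F K L E N : FT) (g h : T * T).
Implicit Types mu nu : probability FT R.

Lemma circle_uncountable : ~ countable [set: T].
Proof.
move=> cT.
have : countable (`[0, 1[%classic : set R).
  rewrite (_ : `[0, 1[%classic = @cval R @` setT).
    exact: (card_le_trans (card_image_le _ _) cT).
  apply/seteqP; split => [c|_ [x _ <-]]; rewrite /= in_itv /=.
    by move=> /andP[c0 c1]; exists (to_circle c) => //; exact: cval_to_circle.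
  exact: cvalP.
move/countable_lebesgue_measure0; rewrite lebesgue_measure_itv /= lte_fin ltr01.
by rewrite oppr0 adde0 => -[/eqP]; rewrite oner_eq0.
Qed.

Definition isolated a s : set FT := ~` avoid [set s] `&` avoid (oarc a s).

Lemma measurable_avoid1 s : measurable (avoid [set s] : set FT).
Proof. by apply: measurable_avoid_compact; exact: compact_set1. Qed.

Lemma measurable_isolated a s : measurable (isolated a s).
Proof.
apply: measurableI; first by apply: measurableC; exact: measurable_avoid1.
by apply: measurable_avoid_open; exact: open_oarc.
Qed.

Lemma oarc_total a s s' : s <> s' -> ~ oarc a s s' -> oarc a s' s.
Proof. arc. Qed.

Lemma left_arc_sub_far n t s p p' y : oarc n s y -> oarc t s n -> ~ oarc t s p ->
  oarc p p' s -> carc p p' y.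
Proof. arc. Qed.

Lemma left_arc_sub s p p' y : oarc p s y -> oarc p p' s -> carc p p' y.
Proof. arc. Qed.

Lemma oarc_end_trans t s n y : oarc t s n -> oarc n s y -> oarc t s y.
Proof. arc. Qed.

Lemma carc_oarcN s t x : s <> t -> carc s t x -> ~ oarc t s x.
Proof. arc. Qed.

Lemma avoid1P s F : avoid [set s] F <-> ~ cset F s.
Proof.
split=> [/avoidP h Fs|Fs]; first by apply: (h _ Fs).
by apply/avoidP => x + xs; rewrite xs.
Qed.

(** Such an s is the first point of [F] met after a. Hence, for a fixed dense point a, these events
    are disjoint in s, and only countably many of them have positive probability. *)
Lemma isolated_inj a s s' F : isolated a s F -> isolated a s' F -> s = s'.
Proof.
move=> [/avoid1P/contrapT Fs /avoidP h] [/avoid1P/contrapT Fs' /avoidP h'].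
apply: contrapT => ss'; apply: (h' _ Fs); apply: oarc_total => //.
exact: h.
Qed.

Lemma quasistationary_avoid1 mu s s' : quasistationary mu ->
  (mu (avoid [set s]) = 0%E -> mu (avoid [set s']) = 0%E) /\
  (mu (~` avoid [set s]) = 0%E -> mu (~` avoid [set s']) = 0%E).
Proof.
move=> /(_ (s' - s)) mus.
have /equivalentP h : equivalent (pshift (s' - s) mu) mu := mus.
have E : @translate R (s' - s) @^-1` avoid [set s'] = avoid [set s].
  rewrite preimage_translate; congr avoid; apply/seteqP; split => x.
    by move=> [_ -> <-] /=; rewrite opprB addrCA subrr addr0.
  by move=> ->; exists s' => //; rewrite opprB addrCA subrr addr0.
split=> h0; apply/(h _ _).
- exact: measurable_avoid1.
- by rewrite -[LHS]/(mu (translate (s' - s) @^-1` _)) E.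
- by apply: measurableC; exact: measurable_avoid1.
- by rewrite -[LHS]/(mu (translate (s' - s) @^-1` ~` _)) -preimage_setC E.
Qed.

(* If s is hit with a probability strictly between 0 and 1, then by
   factorization it is with positive probability hit by the part of the set
   after s and missed by the part before it, hence isolated from the left. *)
Lemma isolated_pos mu s : quasifactorizing mu ->
  mu (avoid [set s]) != 0%E -> mu (~` avoid [set s]) != 0%E ->
  exists n, mu (isolated (rpt R n) s) != 0%E.
Proof.
move=> fact mu0 mu1; apply: contrapT => /forallNP h0.
have {}h0 n : mu (isolated (rpt R n) s) = 0%E by have /negP/negPn/eqP := h0 n.
have [t /oarcP st'] := oarc_neq0 s s.
have st : s <> t by move=> st; move: st'; rewrite -st; lra.
clear st'.
have /equivalentP h : equivalent mu (pconv (ptr (karc s t) mu) (ptr (karc t s) mu)).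
  by apply: fact; apply/eqP.
pose U := \bigcup_n isolated (rpt R n) s.
have mU : measurable U by apply: bigcupT_measurable => n; exact: measurable_isolated.
have U0 : mu U = 0%E.
  apply: measure_negligible => //; apply: negligible_bigcup => n.
  by apply/negligibleP; [exact: measurable_isolated|exact: h0].
have := (h _ mU).1 U0; apply/eqP.
pose A1 : set FT := ~` avoid [set s] `&` avoid (oarc t s).
pose A2 : set FT := avoid [set s].
have mA1 : measurable A1 by exact: measurable_isolated.
have mA2 : measurable A2 by exact: measurable_avoid1.
have sub : A1 `*` A2 `<=` @cup R @^-1` U.
  move=> [F1 F2] [/= [/avoid1P/contrapT F1s /avoidP F1ts] /avoid1P F2s].
  have oF2 : open (~` (F2 : set T)) by rewrite openC; exact: csetP.
  (* [F2] misses an arc around s. If its left end lies on (t,s), this end serves as the dense point;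
     otherwise every dense point of (t,s) does. *)
  have [p [ps pF2]] := arc_base oF2 F2s.
  suff [n nts nF2] : exists2 n, oarc t s (rpt R n) \/ rpt R n = t &
      forall y, oarc (rpt R n) s y -> ~ cset F2 y.
    exists n => //; split; first by move=> /avoid1P; apply; left.
    apply/avoidP => y [Fy ny|Fy]; last by move/nF2.
    apply: (F1ts _ Fy); case: nts => [nts|<- //]; exact: oarc_end_trans nts ny.
  have [pts|pts] := pselect (oarc t s (rpt R p.1)).
    exists p.1; first by left.
    by move=> y /left_arc_sub => /(_ _ ps)/pF2.
  have [n nts] := rpt_dense t s; exists n; first by left.
  by move=> y ny; apply: pF2; exact: left_arc_sub_far ny nts pts ps.
have E1 : ptr (karc s t) mu A1 = mu (~` avoid [set s]).
  congr (mu _); apply/seteqP; split => F.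
    by move=> [/avoid1P/contrapT[Fs _] _] /avoid1P; exact.
  move=> /avoid1P/contrapT Fs; split.
    by move=> /avoid1P; apply; split => //; exact: carc_endl.
  by apply/avoidP => x [_ stx]; exact: carc_oarcN.
have E2 : ptr (karc t s) mu A2 = mu (avoid [set s]).
  congr (mu _); apply/seteqP; split => F.
    by move=> /avoid1P Fs; apply/avoid1P => Fs'; apply: Fs; split => //; exact: carc_endr.
  by move=> /avoid1P Fs; apply/avoid1P => -[/Fs].
rewrite gt_eqF //.
apply: (@lt_le_trans _ _ ((ptr (karc s t) mu \x ptr (karc t s) mu)%E (A1 `*` A2))).
  rewrite product_measure1E // [X in (X * _)%E]E1 [X in (_ * X)%E]E2.
  by rewrite mule_gt0 // lt_neqAle measure_ge0 andbT eq_sym.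
apply: le_measure; rewrite ?inE //; first exact: measurableX.
by rewrite -[_ @^-1` _]setTI; exact: measurable_cup.
Qed.

Lemma zero_one mu : quasistationary mu -> quasifactorizing mu ->
  (forall s, mu (avoid [set s]) = 0%E) \/ (forall s, mu (~` avoid [set s]) = 0%E).
Proof.
move=> stat fact.
have [h|/eqP h0] := pselect (mu (avoid [set (0 : T)]) = 0%E).
  by left => s; have [+ _] := quasistationary_avoid1 0 s stat; apply.
have [h|/eqP h1] := pselect (mu (~` avoid [set (0 : T)]) = 0%E).
  by right => s; have [_ +] := quasistationary_avoid1 0 s stat; apply.
exfalso; apply: circle_uncountable.
rewrite (_ : setT = \bigcup_n [set s | mu (isolated (rpt R n) s) != 0%E]).
  apply: bigcup_countable => // n _; apply: countable_disjoint_events.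
    by move=> s; exact: measurable_isolated.
  by move=> s s' F; exact: isolated_inj.
apply/seteqP; split => // s _.
have [n ns] : exists n, mu (isolated (rpt R n) s) != 0%E.
  apply: isolated_pos => //.
    by apply/eqP => /((quasistationary_avoid1 s 0 stat).1); exact/eqP.
  by apply/eqP => /((quasistationary_avoid1 s 0 stat).2); exact/eqP.
by exists n.
Qed.

Lemma ae_missed mu s : mu (~` avoid [set s]) = 0%E -> \forall Z \ae mu, ~ cset Z s.
Proof.
move=> h; exists (~` avoid [set s]).
split; [by apply: measurableC; exact: measurable_avoid1|exact: h|].
by move=> Z /= /contrapT Zs /avoid1P.
Qed.

Lemma ae_full mu : (forall s, mu (avoid [set s]) = 0%E) ->
  \forall Z \ae mu, cset Z = setT.
Proof.
move=> h; have : \forall Z \ae mu, forall n, cset Z (rpt R n).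
  apply: ae_foralln => n; exists (avoid [set rpt R n]).
  split; [exact: measurable_avoid1|exact: h|].
  by move=> Z /= Zn; apply/avoid1P.
apply: filterS => Z Zn; apply/seteqP; split => // x _; apply: contrapT => Zx.
have oZ : open (~` (Z : set T)) by rewrite openC; exact: csetP.
have [n [_ /(_ _ (carc_endl _ _))]] := arc_base oZ Zx; exact.
Qed.

End zero_one.

(** * Mixtures over the gap kernel *)

Section mixture_laws.
Variable R : realType.
Local Notation T := (circle R).
Local Notation FT := (closedset (circle R)).
Implicit Types (s t : T) (C Z W F K L E N : FT).
Implicit Types mu nu : probability FT R.

Lemma pmix_comp d (S : measurableType d) (P : probability S R) (f : {mfun S >-> FT})
  (k : FT -> probability FT R)
  (mk : forall B, measurable B -> measurable_fun setT (k ^~ B))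
  (mkf : forall B, measurable B -> measurable_fun setT ((k \o f) ^~ B)) :
  equivalent (pmix P mkf) (pmix (distribution P f) mk).
Proof.
apply: same_equivalent => B mB.
change ((\int[P]_x k (f x) B)%E = (\int[pushforward P f]_x k x B)%E).
by rewrite ge0_integral_pushforward //; exact: mk.
Qed.

Lemma pmix_distribution d (S : measurableType d) (P : probability S R)
  (f : {mfun FT >-> FT}) (k : S -> probability FT R)
  (mk : forall B, measurable B -> measurable_fun setT (k ^~ B))
  (mkf : forall B, measurable B ->
    measurable_fun setT (fun x => (distribution (k x) f : probability FT R) B)) :
  equivalent (distribution (pmix P mk) f) (pmix P (k := fun x => distribution (k x) f) mkf).
Proof. by apply: same_equivalent => B mB. Qed.

Lemma integral_product (mu nu : probability FT R) (f g : FT -> \bar R) :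
  measurable_fun setT f -> measurable_fun setT g ->
  (forall x, 0 <= f x)%E -> (forall x, 0 <= g x)%E ->
  (\int[(mu \x nu)%E]_z (f z.1 * g z.2) = (\int[mu]_x f x) * (\int[nu]_x g x))%E.
Proof.
move=> mf mg f0 g0.
have mfg : measurable_fun setT (fun z : FT * FT => (f z.1 * g z.2)%E).
  by apply: emeasurable_funM; apply: measurableT_comp.
have fg0 (z : FT * FT) : (0 <= f z.1 * g z.2)%E by exact: mule_ge0.
rewrite fubini_tonelli1 //.
rewrite -ge0_integralZr //; last exact: integral_ge0.
by apply: eq_integral => x _; rewrite /fubini_F /= ge0_integralZl.
Qed.

(** On avoidance events a convolution is a product, and by Tonelli the product of the two integrals
    is the integral over the product law. *)
Lemma pconv_pmix mu nu (k k' : FT -> probability FT R)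
  (mk : forall B, measurable B -> measurable_fun setT (k ^~ B))
  (mk' : forall B, measurable B -> measurable_fun setT (k' ^~ B))
  (mkk' : forall B, measurable B ->
     measurable_fun setT (fun z : FT * FT => pconv (k z.1) (k' z.2) B)) :
  equivalent (pconv (pmix mu mk) (pmix nu mk')) (pmix (mu \x nu)%E mkk').
Proof.
apply: avoid_equivalent => C; rewrite pconvE.
change ((\int[mu]_x k x (avoid C) * \int[nu]_x k' x (avoid C))%E =
  (\int[(mu \x nu)%E]_z pconv (k z.1) (k' z.2) (avoid C))%E).
rewrite -integral_product //.
- by apply: eq_integral => z _; rewrite pconvE.
- by apply: mk; exact: measurable_avoid.
- by apply: mk'; exact: measurable_avoid.
Qed.

Lemma ae_product mu nu (P P' : set FT) : (\forall Z \ae mu, P Z) ->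
  (\forall Z \ae nu, P' Z) -> \forall z \ae (mu \x nu)%E, P z.1 /\ P' z.2.
Proof.
move=> [A [mA A0 PA]] [A' [mA' A'0 PA']].
have h : \forall z \ae (mu \x nu)%E, P z.1.
  exists (A `*` setT); split; first exact: measurableX.
    by rewrite product_measure1E // [X in (X * _)%E]A0 mul0e.
  by move=> z /= Pz; split => //=; exact: PA.
have h' : \forall z \ae (mu \x nu)%E, P' z.2.
  exists (setT `*` A'); split; first exact: measurableX.
    by rewrite product_measure1E // [X in (_ * X)%E]A'0 mule0.
  by move=> z /= Pz; split => //=; exact: PA'.
by apply: filterS2 h h'.
Qed.

Lemma measurable_pconv_kernel d (S : measurableType d) (k k' : S -> probability FT R)
  (mk : forall B, measurable B -> measurable_fun setT (k ^~ B))
  (mk' : forall B, measurable B -> measurable_fun setT (k' ^~ B)) B :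
  measurable B -> measurable_fun setT (fun x => pconv (k x) (k' x) B).
Proof.
apply: (measurable_avoid_kernel (k := fun x => pconv (k x) (k' x))) => C.
rewrite (_ : (fun x => _) = fun x => (k x (avoid C) * k' x (avoid C))%E).
  by apply: emeasurable_funM; [apply: mk|apply: mk']; exact: measurable_avoid.
by apply/funext => x; rewrite pconvE.
Qed.

Definition splice s t (z : FT * FT) : FT := cup (cap (karc s t) z.1, cap (karc t s) z.2).

Lemma measurable_splice s t : measurable_fun setT (splice s t).
Proof.
apply: measurableT_comp; first exact: measurable_cup.
by apply: measurable_fun_pair; apply: measurableT_comp => //; exact: measurable_cap.
Qed.
HB.instance Definition _ s t :=
  isMeasurableFun.Build _ _ _ _ (splice s t) (measurable_splice s t).

Lemma splice_equivalent s t mu nu :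
  equivalent (distribution (mu \x nu)%E (splice s t))
    (pconv (ptr (karc s t) mu) (ptr (karc t s) nu)).
Proof.
apply: avoid_equivalent => C; rewrite pconvE !ptrE.
rewrite -[LHS]/((mu \x nu)%E (splice s t @^-1` avoid C)).
rewrite (_ : _ @^-1` _ = avoid (cset C `&` carc s t) `*` avoid (cset C `&` carc t s)).
  rewrite product_measure1E //.
    exact: (measurable_avoid (cap (karc s t) C)).
  exact: (measurable_avoid (cap (karc t s) C)).
rewrite -!(preimage_cap (karc _ _) C).
by have /seteqP[h1 h2] := preimage_cup C; apply/seteqP; split => z;
  [exact: (h1 (cap (karc s t) z.1, cap (karc t s) z.2))
  |exact: (h2 (cap (karc s t) z.1, cap (karc t s) z.2))].
Qed.

End mixture_laws.

(** * Stationarity and factorization of the mixture *)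

Section main.
Variable R : realType.
Local Notation T := (circle R).
Local Notation FT := (closedset (circle R)).
Implicit Types (s t x y u v a b : T) (C Z W F K L E N : FT).
Implicit Types mu nu : probability FT R.

Variable Q0 : probability FT R.
Hypothesis Q0_stationary : quasistationary Q0.
Hypothesis Q0_factorizing : quasifactorizing Q0.
Variable Q : R.-pker (T * T)%type ~> FT.
Hypothesis Q_carried : forall s t, Q (s, t) (subsets_of_carc s t) = 1%E.
Hypothesis Q1 : forall r s t,
  same_measure (Q (s + r, t + r)) (shift_law (Q (s, t)) r).
Hypothesis Q2 : forall r r' s t t',
  (oarc r t `&` oarc r t' `&` oarc r' t `&` oarc r' t') s ->
  equivalent (restr_law (Q (r, t)) r s) (restr_law (Q (r, t')) r s) /\
  equivalent (restr_law (Q (r, t)) s t) (restr_law (Q (r', t)) s t).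
Hypothesis Q3 : forall r t s, oarc r t s ->
  equivalent (Q (r, t)) (convolution (restr_law (Q (r, t)) r s) (restr_law (Q (r, t)) s t)).
Hypothesis Q4 : forall r s s' t, carc s s' `<=` oarc r t ->
  equivalent (restr_law (Q (r, t)) s s') (restr_law Q0 s s').
Variable (q : FT -> probability FT R).
Hypothesis q_def : gap_kernel Q0 Q q.

Let mq := measurable_gap_kernel q_def.

Lemma gap_kernel_shift (r : T) Z : equivalent (pshift r (q Z)) (q (translate r Z)).
Proof.
have [Z0|Z0] := pselect (Z = set0 :> set T); last first.
  exact/equivalent_sym/gap_kernel_translate.
have qZ : equivalent (q Z) Q0 by apply: same_equivalent; exact: (q_def Z).1 Z0.
have qZr : equivalent (q (translate r Z)) Q0.
  by apply: same_equivalent; apply: (q_def _).1; rewrite /= Z0 image_set0.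
apply: (equivalent_trans (pshift_equivalent r qZ)).
exact: equivalent_trans (Q0_stationary r) (equivalent_sym qZr).
Qed.

Lemma gap_kernel_splice s t Z Z' : s <> t ->
  ~ cset Z s -> ~ cset Z t -> ~ cset Z' s -> ~ cset Z' t ->
  equivalent (q (splice s t (Z, Z')))
    (pconv (ptr (karc s t) (q Z)) (ptr (karc t s) (q Z'))).
Proof.
move=> st Zs Zt Zs' Zt'; set W := splice s t (Z, Z').
have WP x : cset W x <-> (cset Z x /\ carc s t x) \/ (cset Z' x /\ carc t s x) by [].
have Ws : ~ cset W s by case/WP => -[].
have Wt : ~ cset W t by case/WP => -[].
apply: (@equivalent_trans _ _ _ _ (pconv (ptr (karc s t) (q W)) (ptr (karc t s) (q W)))).
  (* The two traces can be empty although [Z] and [Z'] are not; then the quasifactorization of [Q0]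
     replaces the splitting of the gap kernel. *)
  have [W0|W0] := pselect (W = set0 :> set T); last exact: gap_kernel_splits.
  have qW : equivalent (q W) Q0 by apply: same_equivalent; exact: (q_def W).1 W0.
  apply: (equivalent_trans qW).
  apply: (@equivalent_trans _ _ _ _ (pconv (ptr (karc s t) Q0) (ptr (karc t s) Q0))).
    by apply: Q0_factorizing; apply/eqP.
  by apply: equivalent_sym; apply: pconv_equivalent; exact: ptr_equivalent.
have ts : t <> s by move/esym.
apply: pconv_equivalent.
  apply: (gap_kernel_local Q_carried Q2 Q3 Q4 q_def) => // x stx.
  split=> [/WP[[]//|[Zx tsx]]|Zx]; last by apply/WP; left.
  (* A point on both arcs is s or t, and neither set contains these. *)
  by case: (carcI_ends stx tsx st) => xE; rewrite xE in Zx.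
apply: (gap_kernel_local Q_carried Q2 Q3 Q4 q_def) => // x tsx.
split=> [/WP[[Zx stx]|[]//]|Zx]; last by apply/WP; right.
by case: (carcI_ends stx tsx st) => xE; rewrite xE in Zx.
Qed.

Lemma gap_kernel_full Z C : Z = setT :> set T -> C <> set0 :> set T ->
  q Z (avoid C) = 0%E.
Proof.
move=> ZT C0; apply: (gap_kernel_hit q_def).
  by move=> Z0; have : set0 (0 : T) by rewrite -Z0 ZT.
by move=> /avoidP h; apply: C0; apply/seteqP; split => // x Cx; apply: (h x) => //; rewrite ZT.
Qed.

(** Here s and t do belong to the sets, so the splitting does not apply. But the splice is again the
    full circle, and both sides give [avoid C] probability 1 for empty [C] and 0 otherwise. *)
Lemma gap_kernel_splice_full s t Z Z' : Z = setT :> set T -> Z' = setT :> set T ->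
  equivalent (q (splice s t (Z, Z')))
    (pconv (ptr (karc s t) (q Z)) (ptr (karc t s) (q Z'))).
Proof.
move=> ZT ZT'; set W := splice s t (Z, Z').
have WT : W = setT :> set T.
  apply/seteqP; split => // x _; case: (carc_cover s t x) => ?; [left|right].
    by split => //; rewrite ZT.
  by split => //; rewrite ZT'.
apply: avoid_equivalent => C; rewrite pconvE.
have -> : ptr (karc s t) (q Z) (avoid C) = q Z (avoid (cap (karc s t) C)) by exact: ptrE.
have -> : ptr (karc t s) (q Z') (avoid C) = q Z' (avoid (cap (karc t s) C)) by exact: ptrE.
have full V A : A = set0 :> set T -> q V (avoid A) = 1%E.
  by move=> ->; rewrite avoid0 probability_setT.
have [C0|C0] := pselect (C = set0 :> set T).
  by rewrite !full ?mule1 //= C0 set0I.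
rewrite gap_kernel_full //.
have [h1|h1] := pselect (cap (karc s t) C = set0 :> set T); last first.
  by rewrite (gap_kernel_full ZT h1) mul0e.
have [h2|h2] := pselect (cap (karc t s) C = set0 :> set T); last first.
  by rewrite (gap_kernel_full ZT' h2) mule0.
exfalso; apply: C0; apply/seteqP; split => // x Cx.
case: (carc_cover s t x) => sx; first by have : set0 x by rewrite -h1.
by have : set0 x by rewrite -h2.
Qed.

Lemma mixture_stationary mu : quasistationary mu -> quasistationary (pmix mu mq).
Proof.
move=> stat t.
have m1 B : measurable B -> measurable_fun setT (fun Z => pshift t (q Z) B).
  by move=> mB; apply: mq; rewrite -[_ @^-1` _]setTI; exact: measurable_translate.
have m2 B : measurable B -> measurable_fun setT ((q \o translate t) ^~ B).
  by move=> mB; apply: (measurableT_comp (mq mB)); exact: measurable_translate.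
apply: (equivalent_trans (pmix_distribution mu (f := translate t) mq m1)).
apply: (@equivalent_trans _ _ _ _ (pmix mu m2)).
  by apply: pmix_equivalent_ae; apply: nearW => Z; exact: gap_kernel_shift.
apply: (equivalent_trans (pmix_comp mu (f := translate t) mq m2)).
by apply: (pmix_equivalent_base (P := pshift t mu) (P' := mu)); exact: stat.
Qed.

(** [mu] is replaced by the equivalent law of the splice of two independent sets of law [mu]. Both
    sides then become mixtures over pairs, the right one by [pconv_pmix], and the kernels are
    compared for almost every pair. *)
Lemma mixture_factorizing mu : quasistationary mu -> quasifactorizing mu ->
  quasifactorizing (pmix mu mq).
Proof.
move=> stat fact s t /[dup] nst /eqP st.
change (equivalent (pmix mu mq)
  (pconv (ptr (karc s t) (pmix mu mq)) (ptr (karc t s) (pmix mu mq)))).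
have mt K B : measurable B -> measurable_fun setT (fun Z => ptr K (q Z) B).
  by move=> mB; apply: mq; rewrite -[_ @^-1` _]setTI; exact: measurable_cap.
have mk B : measurable B -> measurable_fun setT (fun z : FT * FT =>
    pconv (ptr (karc s t) (q z.1)) (ptr (karc t s) (q z.2)) B).
  apply: (measurable_pconv_kernel (k := fun z : FT * FT => ptr (karc s t) (q z.1))
    (k' := fun z : FT * FT => ptr (karc t s) (q z.2))) => A mA.
    exact: (measurableT_comp (mt (karc s t) A mA) measurable_fst).
  exact: (measurableT_comp (mt (karc t s) A mA) measurable_snd).
have ms B : measurable B -> measurable_fun setT ((q \o splice s t) ^~ B).
  by move=> mB; apply: (measurableT_comp (mq mB)); exact: measurable_splice.
have fmu : equivalent mu (distribution (mu \x mu)%E (splice s t)).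
  apply: (equivalent_trans (fact s t nst)).
  exact: equivalent_sym (splice_equivalent s t mu mu).
apply: (equivalent_trans (pmix_equivalent_base mq fmu)).
apply: (equivalent_trans (equivalent_sym (pmix_comp (mu \x mu)%E (f := splice s t) mq ms))).
apply: (@equivalent_trans _ _ _ _ (pmix (mu \x mu)%E mk)); last first.
  apply: equivalent_sym.
  apply: (equivalent_trans (pconv_equivalent (pmix_distribution mu (f := cap _) mq (mt (karc s t)))
     (pmix_distribution mu (f := cap _) mq (mt (karc t s))))).
  exact: pconv_pmix.
apply: pmix_equivalent_ae.
case: (zero_one stat fact) => [full|missed].
  have := ae_product (ae_full full) (ae_full full).
  by apply: filterS => -[Z Z'] /= [ZT ZT']; exact: gap_kernel_splice_full.
have h : \forall Z \ae mu, ~ cset Z s /\ ~ cset Z t.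
  by apply: filterS2 (ae_missed (missed s)) (ae_missed (missed t)) => Z.
have := ae_product h h.
by apply: filterS => -[Z Z'] /= [[Zs Zt] [Zs' Zt']]; exact: gap_kernel_splice.
Qed.

End main.

Theorem corollary4p17 (R : realType)
  (Q0 : probability (closedset (circle R)) R)
  (Q0_stationary : quasistationary Q0)
  (Q0_factorizing : quasifactorizing Q0)
  (Q : R.-pker (circle R * circle R)%type ~> closedset (circle R))
  (Q_carried : forall s t : circle R, Q (s, t) (subsets_of_carc s t) = 1%E)
  (Q1 : forall r s t : circle R,
     same_measure (Q (s + r, t + r)) (shift_law (Q (s, t)) r))
  (Q2 : forall r r' s t t' : circle R,
     (oarc r t `&` oarc r t' `&` oarc r' t `&` oarc r' t') s ->
     equivalent (restr_law (Q (r, t)) r s) (restr_law (Q (r, t')) r s) /\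
     equivalent (restr_law (Q (r, t)) s t) (restr_law (Q (r', t)) s t))
  (Q3 : forall r t s : circle R, oarc r t s ->
     equivalent (Q (r, t)) (convolution (restr_law (Q (r, t)) r s) (restr_law (Q (r, t)) s t)))
  (Q4 : forall r s s' t : circle R, carc s s' `<=` oarc r t ->
     equivalent (restr_law (Q (r, t)) s s') (restr_law Q0 s s'))
  (q : closedset (circle R) -> probability (closedset (circle R)) R)
  (q_def : gap_kernel Q0 Q q) :
  (forall B, measurable B -> measurable_fun [set: closedset (circle R)] (q ^~ B)) /\
  forall M : set (probability (closedset (circle R)) R),
    measure_type M -> stationary M -> factorizing M ->
    [/\ measure_type (type_comp M q), stationary (type_comp M q)
      & factorizing (type_comp M q)].
Proof.
have mq := measurable_gap_kernel q_def.
split=> // M [mu0 ME] Mstat Mfact.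
have Mmu0 : M mu0 by rewrite ME; exact: equivalent_refl.
(* The class of a mixture depends only on the class of the mixing law, so [type_comp M q] is the
   class of one mixture, and both properties transfer from it to every member. *)
have mixE nu : type_comp M q nu <-> equivalent nu (pmix mu0 mq).
  split=> [[mu + numu]|nu0]; last by exists mu0.
  rewrite ME => mumu0; apply: (equivalent_trans numu).
  exact: (pmix_equivalent_base (P := mu) (P' := mu0) mq mumu0).
have stat0 : quasistationary (pmix mu0 mq).
  exact: (mixture_stationary Q0_stationary Q1 q_def (Mstat _ Mmu0)).
have fact0 : quasifactorizing (pmix mu0 mq).
  exact: (mixture_factorizing Q0_factorizing Q_carried Q2 Q3 Q4 q_def
    (Mstat _ Mmu0) (Mfact _ Mmu0)).
split.
- by exists (pmix mu0 mq); apply/seteqP; split => nu /mixE.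
- move=> nu /mixE nuE t.
  apply: equivalent_trans (equivalent_sym nuE).
  apply: equivalent_trans (stat0 t).
  exact: (pshift_equivalent t nuE).
- move=> nu /mixE nuE s t st; apply: (equivalent_trans nuE).
  apply: (equivalent_trans (fact0 s t st)).
  apply: equivalent_sym.
  by apply: (@pconv_equivalent _ (ptr (karc s t) nu) (ptr (karc s t) (pmix mu0 mq))
    (ptr (karc t s) nu) (ptr (karc t s) (pmix mu0 mq))); exact: ptr_equivalent.
Qed.
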